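(* Let $q$ be an odd prime. Let $k/\mathbb{F}_q$ be a field extension of degree $r$, let $\ell$ be a prime such that $(\mathbb{Z}/\ell\mathbb{Z})^\times = \langle q\rangle \times S$ for some subgroup $S$ and $\#\langle q\rangle = 2rs$ for some integer $s$, and let $h$ be a polynomial of degree $s$ irreducible over $k$. Then Rains' conic algorithm (described in the context) is correct: on input $q,r,\ell,s$ it returns an element in the same Galois orbit over $\mathbb{F}_q$ as Rains' cyclotomic algorithm (described in the context) on input $q,r,\ell,2s$. It computes its output using $$O\bigl(\mathsf{M}(sr)(sr\log(q)+(\ell/r)\log(\ell))\bigr)$$ operations in $\mathbb{F}_q$ on average, or $\tilde{O}((sr)^2\log(q))$ assuming $\ell\in o(sr^2)$.
   Context: For an element $\theta$ of a finite field and an integer $n\ge0$, let $[n]\theta=\theta_n$, where $\theta_0=2$, $\theta_1=\theta$, $\theta_{i+1}=\theta\theta_i-\theta_{i-1}$. Rains' conic algorithm (input $k,\ell,S,s,h$ as in the claim): (1) construct the field $k'=k[Z]/h(Z)$; (2) repeat: take random $\theta\in k'$ until $\theta^2-4$ is a quadratic non-residue in $k'$, and compute $\zeta=[(\#k'+1)/\ell]\theta$; until $\zeta\neq2$; (3) compute $\eta(\zeta)=\sum_{\sigma\in S}[\sigma]\zeta$; (4) return $\alpha=\mathrm{Tr}_{k'/k}\,\eta(\zeta)=\sum_{i=0}^{s-1}[q^{ri}]\eta(\zeta)$. Rains' cyclotomic algorithm on input $q,r,\ell,s'$, where $(\mathbb{Z}/\ell\mathbb{Z})^\times = \langle q\rangle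 \times S$ with $\#\langle q\rangle=rs'$, together with a polynomial of degree $s'$ irreducible over $k$: construct the extension $k''$ of $k$ of degree $s'$ defined by that polynomial; take random $\theta\in k''$ until $\zeta=\theta^{(\#k''-1)/\ell}$ is a primitive $\ell$-th root of unity; return $\mathrm{Tr}_{k''/k}\bigl(\sum_{\sigma\in S}\zeta^\sigma\bigr)$. Its output is a normal generator of $k$ over $\mathbb{F}_q$ whose Galois orbit over $\mathbb{F}_q$ does not depend on the choice of $\zeta$. Both algorithms use the same $S$. Cost model: costs are counted in number of operations $+,\times,\div$ in $\mathbb{F}_q$; the algorithm is randomized and $O(\,)$ denotes average (expected) cost; $\tilde O(\,)$ neglects logarithmic factors in the parameters. $\mathsf{M}(m)$ is a function such that polynomials in $\mathbb{F}_q[X]$ of degree less than $m$ can be multiplied in $\mathsf{M}(m)$ operations in $\mathbb{F}_q$, with the usual super-linearity assumptions ($\mathsf{M}(n)/n\ge \mathsf{M}(m)/m$ for $n\ge m$, $\mathsf{M}(mn)\le m^2\mathsf{M}(n)$), and $\mathsf{M}(mn)\in O(m^{1+\varepsilon}\mathsf{M}(n))$ for all $\varepsilon>0$; one can take $\mathsf{M}(m)\in O(m\log(m)\log\log(m))$. *)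

(* Defs.v *)
From HB Require Import structures.
From mathcomp Require Import all_boot all_order all_algebra all_fingroup.
From mathcomp Require Import all_solvable all_field qpoly qfpoly.
From mathcomp Require Import all_classical all_reals all_analysis.

Set Implicit Arguments.
Unset Strict Implicit.
Unset Printing Implicit Defensive.

Import Order.TTheory GRing.Theory Num.Theory.
Import numFieldNormedType.Exports.
Local Open Scope classical_set_scope.
Local Open Scope ring_scope.

Inductive arith := Add | Sub | Mul | Div.

(* [(o, i, j)] applies [o] to the cells [i] and [j] of the memory and appends
   the result to the memory. *)
Definition instr := (arith * nat * nat)%type.

Record slp := Slp { code : seq instr; outs : seq nat }.

(* A division by zero aborts the run. *)
Definition slp_step (F : fieldType) (mem : seq F) (c : instr) :
    option (seq F) :=
  let: (o, i, j) := c in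
  let a := nth 0 mem i in
  let b := nth 0 mem j in
  match o with
  | Add => Some (rcons mem (a + b))
  | Sub => Some (rcons mem (a - b))
  | Mul => Some (rcons mem (a * b))
  | Div => if b == 0 then None else Some (rcons mem (a / b))
  end.

(* The memory initially holds the constants 0 and 1, followed by the input; no
   other constant is available for free. *)
Definition slp_run (F : fieldType) (p : slp) (x : seq F) : option (seq F) :=
  omap (fun mem => [seq nth 0 mem i | i <- outs p])
    (foldl (fun mem c => obind (fun m => slp_step m c) mem)
       (Some [:: 0, 1 & x]) (code p)).

Definition slp_cost (p : slp) : nat := size (code p).

(* [Tick n] spends [n] operations, [Unif T] draws a uniform element of [T], and
   [Until c t] runs [c] afresh until its result satisfies [t]. *)
Inductive comp : Type -> Type :=
| Ret (A : Type) (a : A) : comp A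
| Tick (n : nat) : comp unit
| Unif (T : finType) : comp T
| Bind (B A : Type) (c : comp B) (f : B -> comp A) : comp A
| Until (A : Type) (c : comp A) (t : pred A) : comp A.

Notation "x <-- c1 ; c2" := (Bind c1 (fun x => c2))
  (at level 81, c1 at next level, right associativity).

(* The values that a terminating run can return. *)
Fixpoint outcome (A : Type) (c : comp A) : A -> Prop :=
  match c in comp A return A -> Prop with
  | Ret _ a => fun b => b = a
  | Tick _ => fun=> True
  | Unif _ => fun=> True
  | Bind _ _ c f => fun a => exists2 b, outcome c b & outcome (f b) a
  | Until _ c t => fun a => outcome c a /\ t a
  end.

(* Expectation of [kappa] times the number of operations spent, plus [f] of the
   returned value (for [kappa] and [f] nonnegative).  For a loop it is the least
   fixpoint of the unfolding equation: the n-th iterate only accounts for the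
   first n turns. *)
Fixpoint mean (R : realType) (kappa : R) (A : Type) (c : comp A) :
    (A -> \bar R) -> \bar R :=
  match c in comp A return (A -> \bar R) -> \bar R with
  | Ret _ a => fun f => f a
  | Tick n => fun f => ((kappa * n%:R)%:E + f tt)%E
  | Unif T => fun f => (((#|T|%:R)^-1)%:E * \sum_(t : T) f t)%E
  | Bind _ _ c g => fun f => mean kappa c (fun b => mean kappa (g b) f)
  | Until _ c t => fun f =>
      ereal_sup (range (fun n : nat =>
        iter n (fun X => mean kappa c (fun a => if t a then f a else X)) 0%E))
  end.

Definition expected_cost (R : realType) (A : Type) (c : comp A) : \bar R :=
  mean 1 c (fun=> 0%E).

Definition termination_prob (R : realType) (A : Type) (c : comp A) : \bar R :=
  mean 0 c (fun=> 1%E).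

(* The quotients of [qfpoly] require a monic modulus: K[Z]/h(Z) is formed below
   with the monic associate of h. *)
Definition monicize (K : fieldType) (h : {poly K}) : {poly K} :=
  (lead_coef h)^-1 *: h.

Lemma monicize_irreducible (K : fieldType) (h : {poly K}) :
  irreducible_poly h -> monic_irreducible_poly (monicize h).
Proof.
move=> [h_gt1 h_irr].
have h_neq0 : lead_coef h != 0.
  by rewrite lead_coef_eq0 -size_poly_eq0 -lt0n (ltn_trans _ h_gt1).
have c_neq0 : (lead_coef h)^-1 != 0 by rewrite invr_eq0.
split; last by rewrite monicE lead_coefZ mulVf.
split=> [|d d_size d_dvd]; first by rewrite size_scale.
rewrite /monicize dvdpZr // in d_dvd.
by rewrite /monicize eqp_sym (eqp_ltrans (eqp_scale _ c_neq0)) eqp_sym h_irr.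
Qed.

Notation quo hI := {poly %/ _ with monicize_irreducible hI}.

(* Tr a for the extension K[Z]/h(Z) of K: the trace of the multiplication by
   [a], written in the basis 1, Z, ..., Z^(deg h - 1). *)
Definition quo_trace (K : fieldType) (h : {poly K}) (hI : irreducible_poly h)
    (a : quo hI) : K :=
  \tr (\matrix_(i < (size h).-1, j < (size h).-1)
         (a * ('qX : {poly %/ monicize h}) ^+ j : quo hI)`_i).

(* [n]t, with theta_0 = 2, theta_1 = t and theta_(n+2) = t theta_(n+1) - theta_n *)
Fixpoint bracket (K : nzRingType) (n : nat) (t : K) : K :=
  match n with
  | 0 => 2%:R
  | n1.+1 => match n1 with
             | 0 => t
             | n2.+1 => t * bracket n1 t - bracket n2 t
             end
  end.

Record params := Params {
  q : nat; r : nat; l : nat; s : nat;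
  Sgrp : {group {unit 'Z_l}};
  qmod : {unit 'Z_l};
  q_prime : prime q;
  q_odd : odd q;
  l_prime : prime l;
  qmodE : FinRing.uval qmod = q%:R;
  unitsE : (<[qmod]> \x Sgrp)%g = units_Zp l;
  order_qmod : #[qmod]%g = (2 * r * s)%N
}.

(* The field k is represented on the power basis of a generator x, that is, as
   F_q[X]/f(X) with f the minimal polynomial of x. *)
Record input (P : params) := Input {
  k : fieldExtType 'F_(q P);
  x : k;
  h : {poly finvect_type k};
  k_degree : \dim {:k} = r P;
  x_gen : <<1; x>>%VS = fullv;
  h_size : size h = (s P).+1;
  h_irr : irreducible_poly h
}.

Definition nonresidue (K : finFieldType) (a : K) : bool :=
  ~~ [exists b, b ^+ 2 == a].

Section Conic.
Variables (P : params) (D : input P).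
Local Notation k' := (quo (h_irr D)).

Definition zeta_of (theta : k') : k' :=
  bracket ((#|{: k'}| + 1) %/ l P) theta.

Definition eta (zeta : k') : k' :=
  \sum_(sigma in Sgrp P) bracket (FinRing.uval sigma : 'Z_(l P)) zeta.

Inductive task := Construct | Residuosity | Zeta | NotTwo | Eta | Trace.

(* [cost i] is the number of operations spent each time task [i] is done; the
   drawing of theta, besides the tasks, takes no operation. *)
Definition rains_conic (cost : task -> nat) : comp (finvect_type (k D)) :=
  _ <-- Tick (cost Construct);
  zeta <--
    Until
      (theta <--
         Until (theta <-- Unif k';
                _ <-- Tick (cost Residuosity);
                Ret theta)
           (fun theta => nonresidue (theta ^+ 2 - 4%:R));
       _ <-- Tick (cost Zeta);
       _ <-- Tick (cost NotTwo);
       Ret (zeta_of theta))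
      (fun zeta => zeta != 2%:R);
  _ <-- Tick (cost Eta);
  _ <-- Tick (cost Trace);
  Ret (quo_trace (eta zeta)).

(* Rains' cyclotomic algorithm, with k'' = k[Z]/g(Z). *)
Definition rains_cyclotomic (g : {poly finvect_type (k D)})
    (g_irr : irreducible_poly g) : comp (finvect_type (k D)) :=
  zeta <--
    Until (theta <-- Unif (quo g_irr);
           Ret (theta ^+ ((#|{: quo g_irr}| - 1) %/ l P)))
      (fun zeta => (l P).-primitive_root zeta);
  Ret (quo_trace
         (\sum_(sigma in Sgrp P) zeta ^+ (FinRing.uval sigma : 'Z_(l P)))).

Definition coords (a : finvect_type (k D)) : seq 'F_(q P) :=
  [seq coord [tuple x D ^+ i | i < r P] i (a : k D) | i <- enum 'I_(r P)].

Definition coords' (a : k') : seq 'F_(q P) :=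
  flatten [seq coords a`_j | j <- iota 0 (s P)].

(* f is given by the coordinates of X^r mod f, and h by its coefficients. *)
Definition input_coords : seq 'F_(q P) :=
  coords (x D ^+ r P) ++ flatten [seq coords (h D)`_j | j <- iota 0 (s P).+1].

(* [T] is what the construction of k' leaves at the disposal of the other
   tasks.  A test is carried out by computing a vector which vanishes or not
   according to its result. *)
Definition implements (A : task -> slp) : Prop :=
  exists2 T, slp_run (A Construct) input_coords = Some T &
  [/\ forall theta : k',
        exists2 v, slp_run (A Residuosity) (T ++ coords' theta) = Some v &
                   all (pred1 0) v = nonresidue (theta ^+ 2 - 4%:R),
      forall theta : k',
        slp_run (A Zeta) (T ++ coords' theta) = Some (coords' (zeta_of theta)),
      forall zeta : k',
        exists2 v, slp_run (A NotTwo) (T ++ coords' zeta) = Some v &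
                   all (pred1 0) v = (zeta == 2%:R),
      forall zeta : k',
        slp_run (A Eta) (T ++ coords' zeta) = Some (coords' (eta zeta)) &
      forall y : k',
        slp_run (A Trace) (T ++ coords' y) = Some (coords (quo_trace y))].

Definition average_cost (R : realType) (A : task -> slp) : \bar R :=
  expected_cost R (rains_conic (fun i => slp_cost (A i))).

Definition same_galois_orbit (a b : finvect_type (k D)) : Prop :=
  exists2 phi : 'End(k D), kAut 1 {:k D} phi & phi a = b.

End Conic.

Section MultiplicationTime.
Variables (R : realType) (M : nat -> R).

(* The same M serves for all the prime fields. *)
Definition multiplication_time : Prop :=
  forall p, prime p -> odd p -> forall m, (0 < m)%N ->
  exists2 A : slp, (slp_cost A)%:R <= M m &
  forall a b : {poly 'F_p}, (size a <= m)%N -> (size b <= m)%N ->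
    slp_run A (mkseq (nth 0 a) m ++ mkseq (nth 0 b) m) =
    Some (mkseq (nth 0 (a * b)) (2 * m).-1).

Definition superlinear : Prop :=
  (forall m n, (0 < m <= n)%N -> M m / m%:R <= M n / n%:R) /\
  (forall m n, (0 < m)%N -> (0 < n)%N -> M (m * n) <= m%:R ^+ 2 * M n).

Definition almost_linear : Prop :=
  forall eps : R, 0 < eps ->
  exists C : R, forall m n, (0 < m)%N -> (0 < n)%N ->
    M (m * n) <= C * m%:R `^ (1 + eps) * M n.

Definition quasilinear : Prop :=
  M =O_\oo (fun m => m%:R * ln m%:R * ln (ln m%:R)).

End MultiplicationTime.

(* Main.v *)
(** The algorithm draws theta with theta^2 - 4 a non-residue, so that
theta = t + 1/t with t of norm one, i.e. t^(#k' + 1) = 1, in an algebraic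
closure. As q^(rs) is the involution -1 of <q>, l divides #k' + 1, and
zeta = w + 1/w for a primitive l-th root of unity w. Let g be the sum of the
w^sigma over S. Then 1/w = w^(q^(rs)) gives eta(zeta) = g + g^(q^(rs)), whose
trace to k is the sum of g^(q^(ri)) for i < 2s: the output of the cyclotomic
algorithm for w. Any other root of unity is w^(q^j sigma) with sigma in S, and
replaces the result by its q^j-th power.

At least one theta in six leaves both loops, since 2 is a value of the Dickson
polynomial of degree (#k' + 1)/l at fewer than (#k' + 1)/l such theta. With k
given on a power basis and k' = k[Z]/h, a product in k' is a Kronecker
substitution followed by two levels of Barrett divisions, that is O(M(sr))
operations, after a schoolbook precomputation of the inverses which fits in the
budget; h is made monic by a Fermat inversion. The residuosity test, zeta and
the trace take O(sr log q) products, and eta takes #S < l/r times O(log l). *)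

From HB Require Import structures.
Require Import Defs.
From mathcomp Require Import all_boot all_order all_algebra all_fingroup.
From mathcomp Require Import all_solvable all_field qpoly qfpoly.
From mathcomp Require Import all_classical all_reals all_analysis.

Set Implicit Arguments.
Unset Strict Implicit.
Unset Printing Implicit Defensive.

From mathcomp Require Import ring lra zify.
Import Order.TTheory GRing.Theory Num.Theory.
Import numFieldNormedType.Exports.
Local Open Scope classical_set_scope.
Local Open Scope ring_scope.

(** * Straight-line programs *)

(** The cost claim asks for programs that depend on the parameters only and never branch: one
    program serves every generator of k, every polynomial h and every element. Everything is
    therefore phrased on cells that are functions of the input, and addresses appear in two places
    only: [reach_slp] turns a derivation into a program, and [slp_reach] takes in the multiplication
    programs that M grants. This rules out Euclidean algorithms, which branch on degrees: the
    residuosity test becomes the vanishing of a value given by Euler's criterion, the inverse of the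
    leading coefficient becomes a power, and reductions become products with precomputed quotients.
    No division instruction is used besides those that the multiplication programs may contain.

    For correctness, the obstacle is that k[Z]/h and k[Z]/g are unrelated quotients, of degrees s
    and 2s. Both are mapped over k into one algebraic closure, where only the images of the two
    outputs are compared; the comparison then descends to k by injectivity. *)

(* The index type of the cells is too large for classical sets, whose universe
   is bounded by that of the choice types. *)
Definition cset (T : Type) := T -> Prop.

Section Cset.
Variable T : Type.
Definition csub (X Y : cset T) := forall z, X z -> Y z.
Definition cunion (X Y : cset T) : cset T := fun z => X z \/ Y z.
Definition cempty : cset T := fun=> False.
Definition csing (a : T) : cset T := fun z => z = a.
(** [List.In] rather than a boolean membership, since cells are functions on an arbitrary type. *)
Definition clist (zs : seq T) : cset T := fun z => List.In z zs.
Definition cfam (J : nat -> cset T) : cset T := fun z => exists j, J j z.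
Definition cfamn n (J : nat -> cset T) : cset T :=
  fun z => exists2 j, (j < n)%N & J j z.

Lemma clist_cat (zs ws : seq T) z :
  clist (zs ++ ws) z <-> clist zs z \/ clist ws z.
Proof. exact: List.in_app_iff. Qed.

Lemma clist_rcons (zs : seq T) y z :
  clist (rcons zs y) z <-> clist zs z \/ z = y.
Proof.
rewrite -cats1 clist_cat; split=> [] [zz|]; try by left.
  by case=> [->|//]; right.
by move=> ->; right; left.
Qed.

Lemma clist_nth (zs : seq T) z0 j :
  (j < size zs)%N -> clist zs (nth z0 zs j).
Proof.
elim: zs j => [//|y zs IH] [|j] /= jn; first by left.
by right; apply: IH.
Qed.

Lemma clist_index (zs : seq T) z0 z :
  clist zs z -> exists2 j, (j < size zs)%N & nth z0 zs j = z.
Proof.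
elim: zs => [//|y zs IH] /= [<-|/IH[j jn <-] ]; first by exists 0%N.
by exists j.+1.
Qed.

Lemma clist_mkseq n (f : nat -> T) z :
  clist [seq f j | j <- iota 0 n] z <-> exists2 j, (j < n)%N & z = f j.
Proof.
rewrite -[iota 0 n]/(iota 0%N n) -/(mkseq f n); split=> [zs|[j jn ->] ].
  have [j] := clist_index z zs; rewrite size_mkseq => jn.
  by rewrite nth_mkseq // => <-; exists j.
by rewrite -(nth_mkseq z f jn); apply: clist_nth; rewrite size_mkseq.
Qed.

End Cset.

Lemma clist_flatten T n (f : nat -> seq T) z :
  clist (flatten [seq f j | j <- iota 0 n]) z
  <-> exists2 j, (j < n)%N & clist (f j) z.
Proof.
have : clist (flatten [seq f j | j <- iota 0 n]) z
    <-> exists2 w, clist [seq f j | j <- iota 0 n] w & clist w z.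
  elim: [seq f j | j <- iota 0 n] => [|w ws IH] /=; first by split=> [|[] ].
  split=> [/clist_cat[wz|/IH[v vs vz] ]|[v [<-|vs] vz] ].
  - by exists w => //; left.
  - by exists v => //; right.
  - by apply/clist_cat; left.
  - by apply/clist_cat; right; apply/IH; exists v.
move=> ->; split=> [ [w /clist_mkseq[j jn ->] fz]|[j jn fz] ];
  first by exists j.
by exists (f j) => //; apply/clist_mkseq; exists j.
Qed.

Arguments cempty {T}.

Declare Scope cset_scope.
Delimit Scope cset_scope with cset.
Notation "X `|` Y" := (cunion X Y) : cset_scope.
Notation "X `<=` Y" := (csub X Y) : cset_scope.

Section Reach.
Variables (F : fieldType) (I : Type).
Local Notation cell := (I -> F).
Local Open Scope cset_scope.
Implicit Types (X Y Z : cset cell) (z : cell) (zs : seq cell).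

Definition arith_eval (o : arith) (a b : F) : option F :=
  match o with
  | Add => Some (a + b)
  | Defs.Sub => Some (a - b)
  | Mul => Some (a * b)
  | Div => if b == 0 then None else Some (a / b)
  end.

Lemma slp_stepE (mem : seq F) o i j :
  slp_step mem (o, i, j)
  = omap (rcons mem) (arith_eval o (nth 0 mem i) (nth 0 mem j)).
Proof. by case: o => //=; case: ifP. Qed.

Definition slp_exec (mem : seq F) (cd : seq instr) : option (seq F) :=
  foldl (fun mem c => obind (fun m => slp_step m c) mem) (Some mem) cd.

Lemma slp_exec_cons (mem : seq F) o i j cd :
  slp_exec mem ((o, i, j) :: cd)
  = obind (fun x : F => slp_exec (rcons mem x) cd)
      (arith_eval o (nth 0 mem i) (nth 0 mem j)).
Proof.
have fold_None (l : seq instr) :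
    foldl (fun mem c => obind (fun m => slp_step m c) mem) None l
    = (None : option (seq F)) by elim: l.
rewrite /slp_exec [LHS]/= -/(slp_step mem (o, i, j)) slp_stepE.
by case: arith_eval.
Qed.

(** Every memory starts with the constants 0 and 1, which are therefore free in any context. *)
Definition base X : cset cell := X `|` (csing (fun=> 0) `|` csing (fun=> 1)).

Definition known X Y : Prop := Y `<=` base X.

Definition derived X z : Prop :=
  exists o a b, [/\ base X a, base X b &
    forall i, arith_eval o (a i) (b i) = Some (z i)].

Fixpoint chain X zs : Prop :=
  if zs is z :: zs' then derived X z /\ chain (csing z `|` X) zs' else True.

(* An address-free reading of straight-line programs: a cell is a function of
   the data [i : I] of the run, and [zs] are the successive results. *)
Definition reach X (c : nat) Y : Prop :=
  exists zs, [/\ (size zs <= c)%N, chain X zs & known (X `|` clist zs) Y].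

Lemma base_sub X Y : X `<=` base Y -> base X `<=` base Y.
Proof. by move=> sXY z [/sXY//|]; right. Qed.

Lemma baseW X Y : X `<=` Y -> base X `<=` base Y.
Proof. by move=> sXY; apply: base_sub => z /sXY; left. Qed.

Lemma known_refl X : known X X.
Proof. by move=> z; left. Qed.

Lemma known_trans Y X Z : known X Y -> known Y Z -> known X Z.
Proof. by move=> kXY kYZ z /kYZ; apply: base_sub. Qed.

Lemma knownW X X' Y : X `<=` X' -> known X Y -> known X' Y.
Proof. by move=> sX kXY z /kXY; apply: baseW. Qed.

Lemma known_sub X Y Y' : Y' `<=` Y -> known X Y -> known X Y'.
Proof. by move=> sY kXY z /sY /kXY. Qed.

Lemma known_set0 X Y : known cempty Y -> known X Y.
Proof. exact: knownW. Qed.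

Lemma known_left X Y Z : known X Z -> known (X `|` Y) Z.
Proof. by apply: knownW => z; left. Qed.

Lemma known_right X Y : known (X `|` Y) Y.
Proof. by move=> z; left; right. Qed.

Lemma knownU X Y Z : known X Y -> known X Z -> known X (Y `|` Z).
Proof. by move=> kY kZ z [/kY|/kZ]. Qed.

Lemma derived_known X X' z : known X' X -> derived X z -> derived X' z.
Proof.
move=> kX [op [a [b [Xa Xb ab] ] ] ]; exists op, a, b.
by split=> //; apply: (base_sub kX).
Qed.

Lemma chain_known X X' zs : known X' X -> chain X zs -> chain X' zs.
Proof.
elim: zs X X' => [//|z zs IH] X X' kX /= [dz ch]; split.
  exact: derived_known dz.
apply: IH ch => y [->|/kX]; first by left; left.
by apply: baseW => w; right.
Qed.

Lemma chain_cat X zs zs' :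
  chain X zs -> chain (X `|` clist zs) zs' -> chain X (zs ++ zs').
Proof.
elim: zs X => [|z zs IH] X /=; first by
    move=> _; apply: chain_known => z [Xz|[] ]; left.
move=> [dz ch] ch'; split=> //; apply: IH => //.
apply: chain_known ch' => y [Xy|]; first by left; left; right.
case=> [<-|zs_y]; first by left; left; left.
by left; right.
Qed.

Lemma reach_known X Y : known X Y -> reach X 0 Y.
Proof. by move=> kXY; exists [::]; split=> //; apply: known_left. Qed.

Lemma reachW X c c' Y : (c <= c')%N -> reach X c Y -> reach X c' Y.
Proof. by move=> le_c [zs [szs ch kY]]; exists zs; rewrite (leq_trans szs). Qed.

Lemma reach_sub X c Y Y' : known Y Y' -> reach X c Y -> reach X c Y'.
Proof.
move=> sY [zs [szs ch kY]]; exists zs; split=> //.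
exact: known_trans kY sY.
Qed.

Lemma reach_weak X X' c Y : known X' X -> reach X c Y -> reach X' c Y.
Proof.
move=> kX [zs [szs ch kY]]; exists zs; split=> //.
  exact: chain_known ch.
apply: known_trans kY => z [/kX|]; first by apply: baseW => w; left.
by left; right.
Qed.

Lemma reach_keep X c Y : reach X c Y -> reach X c (X `|` Y).
Proof.
move=> [zs [szs ch kY]]; exists zs; split=> //; apply: knownU => //.
by apply: known_left; apply: known_refl.
Qed.

Lemma reach_bind Y X c d Z :
  reach X c Y -> reach (X `|` Y) d Z -> reach X (c + d) Z.
Proof.
move=> [zs [szs ch kY]] [ws [sws ch' kZ]].
have kXY : known (X `|` clist zs) (X `|` Y).
  by apply: knownU => // z; left; left.
exists (zs ++ ws); split; first by rewrite size_cat leq_add.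
  by apply: chain_cat => //; apply: chain_known ch'.
apply: known_trans kZ => z [/kXY|ws_z]; last first.
  by left; right; apply/clist_cat; right.
apply: baseW => y [|zs_y]; first by left.
by right; apply/clist_cat; left.
Qed.

Lemma reachU X c d Y Z :
  reach X c Y -> reach X d Z -> reach X (c + d) (Y `|` Z).
Proof.
move=> rY rZ; apply: (reach_bind rY).
have [zs [szs ch kZ]] : reach (X `|` Y) d Z.
  by apply: reach_weak rZ; apply: known_left; apply: known_refl.
exists zs; split=> //; apply: knownU => //.
by apply: known_left; apply: known_right.
Qed.

Lemma reach_bigcup X c n (Y : nat -> cset cell) :
  (forall j, (j < n)%N -> reach X c (Y j)) ->
  reach X (n * c) (cfamn n Y).
Proof.
elim: n => [|n IH] rY; first by
    apply: reach_known => z [].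
rewrite mulSn addnC; have rn : reach X c (Y n) by apply: rY.
have {}IH := IH (fun j jn => rY j (leqW jn)).
apply: reach_sub (reachU IH rn) => z [j /=].
rewrite ltnS leq_eqVlt => /predU1P[->|jn] Yz; first by left; right.
by left; left; exists j.
Qed.

(** Memory is never erased, so all the iterates stay available at the end and not only the last one.
    Barrett's inverse and the trace both need the whole sequence. *)
Lemma reach_iter X c n (Y : nat -> cset cell) :
  known X (Y 0) ->
  (forall j, (j < n)%N -> reach (X `|` Y j) c (Y j.+1)) ->
  reach X (n * c) (cfamn n.+1 Y).
Proof.
move=> kY0; elim: n => [|n IH] rY.
  apply: reach_known => z [j /=]; rewrite ltnS leqn0 => /eqP -> /kY0.
  exact.
rewrite mulSn addnC.
have {}IH := IH (fun j jn => rY j (leqW jn)).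
have rn := rY n (leqnn _).
apply: (reach_bind IH).
have : reach (X `|` cfamn n.+1 Y) c (Y n.+1).
  apply: reach_weak rn => z [Xz|Yz]; left; first by left.
  by right; exists n => /=.
move=> [zs [szs ch kY]]; exists zs; split=> //.
move=> z [j /=]; rewrite ltnS leq_eqVlt => /predU1P[->|jn] Yz; first exact: kY.
by left; left; right; exists j.
Qed.

Lemma reach_op o (a b z : cell) X :
  base X a -> base X b ->
  (forall i, arith_eval o (a i) (b i) = Some (z i)) -> reach X 1 (csing z).
Proof.
move=> Xa Xb ez; exists [:: z]; split=> //.
  by split=> //; exists o, a, b.
by move=> y ->; left; right; left.
Qed.

(** The address of a cell is any position at which it occurs in the list of the cells obtained so
    far; this is why 0 and 1 have to figure in [ms]. *)
Lemma chain_slp_code (ms zs : seq cell) :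
  clist ms (fun=> 0) -> clist ms (fun=> 1) -> chain (clist ms) zs ->
  exists2 cd : seq instr, size cd = size zs & forall i,
    slp_exec [seq m i | m : cell <- ms] cd
    = Some [seq m i | m : cell <- ms ++ zs].
Proof.
elim: zs ms => [|z zs IH] ms ms0 ms1 /=.
  by move=> _; exists [::] => // i; rewrite cats0.
have baseE y : base (clist ms) y -> clist ms y by move=> [//|[->|->]].
move=> [ [op [a [b [/baseE ams /baseE bms ez] ] ] ] ch].
have [|||cd scd cdE] := IH (rcons ms z).
- by apply/clist_rcons; left.
- by apply/clist_rcons; left.
- apply: chain_known ch => y [->|ms_y]; left; apply/clist_rcons; first by right.
  by left.
have [ja ja_ms aE] := clist_index (fun=> 0) ams.
have [jb jb_ms bE] := clist_index (fun=> 0) bms.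
exists ((op, ja, jb) :: cd) => [|i]; first by rewrite /= scd.
rewrite -cat_rcons -cdE map_rcons slp_exec_cons !(nth_map (fun=> 0)) //.
by rewrite aE bE ez.
Qed.

Lemma slp_code_chain (cd : seq instr) (ms : seq cell) (w : I -> seq F) :
  (forall i, slp_exec [seq m i | m : cell <- ms] cd = Some (w i)) ->
  exists zs, [/\ size zs = size cd, chain (clist ms) zs &
    forall i, w i = [seq m i | m : cell <- ms ++ zs]].
Proof.
elim: cd ms => [|[ [op a] b] cd IH] ms wE.
  by exists [::]; split=> // i; have [] := wE i; rewrite cats0.
pose ca := nth (fun=> 0) ms a; pose cb := nth (fun=> 0) ms b.
have nthE i j : nth 0 [seq m i | m : cell <- ms] j = nth (fun=> 0) ms j i.
  have [jm|jm] := ltnP j (size ms); first exact: nth_map.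
  by rewrite !nth_default // size_map.
(* The default 0 is never taken: by [wE] the run succeeds on every datum, so the operation is
   defined. *)
pose z : cell := fun i => odflt 0 (arith_eval op (ca i) (cb i)).
have zE i : arith_eval op (ca i) (cb i) = Some (z i).
  move: (wE i); rewrite slp_exec_cons !nthE /z -/ca -/cb.
  by case: arith_eval.
have [|zs [szs ch zsE]] := IH (rcons ms z).
  by move=> i; rewrite -(wE i) slp_exec_cons !nthE -/ca -/cb zE map_rcons.
exists (z :: zs); split; first by rewrite /= szs.
  have nth_base j : base (clist ms) (nth (fun=> 0) ms j).
    have [jm|jm] := ltnP j (size ms); first by left; apply: clist_nth.
    by right; left; rewrite nth_default.
  split; first by exists op, ca, cb; split=> //; apply: nth_base.
  by apply: chain_known ch => y /clist_rcons[yms|->]; left; [right | left].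
by move=> i; rewrite zsE cat_rcons.
Qed.

Lemma reach_slp (xs ys : seq cell) c :
  reach (clist xs) c (clist ys) ->
  exists2 p : slp, (slp_cost p <= c)%N & forall i,
    slp_run p [seq x i | x : cell <- xs] = Some [seq y i | y : cell <- ys].
Proof.
move=> [zs [szs ch kY]].
pose ms : seq cell := [:: (fun=> 0), (fun=> 1) & xs].
have [|||cd scd cdE] := @chain_slp_code ms zs.
- by left.
- by right; left.
- by apply: chain_known ch => y xs_y; left; right; right.
have addr (ws : seq cell) : (forall y, clist ws y -> clist (ms ++ zs) y) ->
    exists2 js : seq nat, all (fun j => (j < size (ms ++ zs))%N) js &
      [seq nth (fun=> 0) (ms ++ zs) j | j <- js] = ws.
  elim: ws => [|w ws IH] sws; first by exists [::].
  have [|js js_lt jsE] := IH; first by move=> y ws_y; apply: sws; right.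
  have [j jlt jE] := clist_index (fun=> 0) (sws w (or_introl erefl)).
  by exists (j :: js); rewrite /= ?jlt // jE jsE.
have [y /kY|js js_lt jsE] := addr ys.
  move=> [ [xs_y|zs_y]|[->|->] ]; apply/clist_cat; try by [left; left | right].
    by left; right; right.
  by left; right; left.
exists (Slp cd js); first by rewrite /slp_cost /= scd.
move=> i; rewrite -[LHS]/(omap (fun mem : seq F => [seq nth 0 mem a | a <- js])
  (slp_exec [seq m i | m : cell <- ms] cd)) cdE -[in RHS]jsE.
rewrite -map_comp; congr Some; apply/eq_in_map => j /(allP js_lt) jlt.
by rewrite -[LHS]/(nth 0 [seq m i | m : cell <- ms ++ zs] j) (nth_map (fun=>
  0)).
Qed.

(** The converse of [reach_slp], which brings a given program into the address-free calculus.
    Positions beyond the outputs are harmless: [nth] yields the constant 0 there. *)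
Lemma slp_reach (p : slp) (xs : seq cell) (v : I -> seq F) :
  (forall i, slp_run p [seq x i | x : cell <- xs] = Some (v i)) ->
  reach (clist xs) (slp_cost p) (cfam (fun j => csing (fun i => nth 0 (v i)
    j))).
Proof.
move=> vE; pose ms : seq cell := [:: (fun=> 0), (fun=> 1) & xs].
pose w i := odflt [::] (slp_exec [seq m i | m : cell <- ms] (Defs.code p)).
have [i|zs [szs ch wE]] := @slp_code_chain (Defs.code p) ms w.
  have := vE i; rewrite /slp_run /w -[0 :: _]/([seq m i | m : cell <- ms]).
  by rewrite -/(slp_exec _ _); case: slp_exec.
have kms : known (clist xs) (clist ms).
  by move=> y [<-|[<-|yxs] ]; [right; left | right; right | left].
exists zs; split; first by rewrite szs.
  exact: chain_known ch.
move=> _ [j ->].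
pose y : cell := nth (fun=> 0) [seq nth (fun=> 0) (ms ++ zs) a | a <- outs p] j.
have -> : (fun i => nth 0 (v i) j) = y.
  apply/funext => i; have := vE i.
  rewrite /slp_run -[0 :: _]/([seq m i | m : cell <- ms]).
  rewrite -/(slp_exec _ _); have := wE i; rewrite /w;
    case: slp_exec => //= m -> [<-].
  rewrite -/(ms ++ zs) /y.
  have [jm|jm] := ltnP j (size (outs p)); last first.
    by rewrite !nth_default ?size_map.
  rewrite !(nth_map 0%N) //.
  set a := nth 0%N _ _.
  rewrite -[LHS]/(nth 0 [seq m i | m : cell <- ms ++ zs] a).
  have [am|am] := ltnP a (size (ms ++ zs)); last first.
    by rewrite !nth_default // size_map.
  by rewrite (nth_map (fun=> 0)).
rewrite /y; have [jm|jm] := ltnP j (size (outs p)); last first.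
  by right; left; rewrite nth_default ?size_map.
rewrite (nth_map 0%N) //; set a := nth 0%N _ _.
have [am|am] := ltnP a (size (ms ++ zs)); last first.
  by right; left; rewrite nth_default.
have [/kms|azs] := iffLR (clist_cat _ _ _) (clist_nth (fun=> 0) am).
  by apply: baseW => y' ?; left.
by left; right.
Qed.

End Reach.

(** * Coordinates and doubling chains *)

(** The quadratic form a^2 + b^2 - t a b is invariant under (a, b) -> (b, t b - a), and its value is
    taken at (2, t). It closes the induction of [bracket_double] in any commutative ring, where t
    need not have the form x + 1/x. *)
Lemma bracket_norm (K : comNzRingType) (n : nat) (t : K) :
  bracket n t ^+ 2 + bracket n.+1 t ^+ 2 - t * bracket n t * bracket n.+1 t
  = 4%:R - t ^+ 2.
Proof.
elim: n => [|n IH]; first by rewrite /=; ring.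
rewrite -{}IH.
rewrite -[bracket n.+2 t]/(t * bracket n.+1 t - bracket n t).
by ring.
Qed.

Lemma bracket_double (K : comNzRingType) (n : nat) (t : K) :
  bracket n.*2 t = bracket n t ^+ 2 - 2%:R /\
  bracket n.*2.+1 t = bracket n t * bracket n.+1 t - t.
Proof.
elim: n => [|n [IH1 IH2] ]; first by rewrite /=; split; ring.
have nE := bracket_norm n t.
have E1 : bracket n.+1.*2 t = bracket n.+1 t ^+ 2 - 2%:R.
  rewrite doubleS.
  rewrite -[bracket _.+2 t]/(t * bracket n.*2.+1 t - bracket n.*2 t) IH1 IH2.
  have -> : bracket n.+1 t ^+ 2
      = 4%:R - t ^+ 2 - bracket n t ^+ 2 + t * bracket n t * bracket n.+1 t.
    by rewrite -nE; ring.
  by ring.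
split=> //; rewrite doubleS.
rewrite -[bracket _.+3 t]/(t * bracket n.+1.*2 t - bracket n.*2.+1 t) E1 IH2.
rewrite -[bracket n.+2 t]/(t * bracket n.+1 t - bracket n t).
by ring.
Qed.

Section Coded.
Local Open Scope cset_scope.
Variables (F : fieldType) (I : Type).
Local Notation cell := (I -> F).
Implicit Types X T : cset cell.

(* [cd u] are the cells that hold the coordinates of [u]; the products may use
   the precomputed cells of [T]. *)
Record coded T (R : I -> comNzRingType) (cd : (forall i, R i) -> cset cell)
    (ca cm : nat) : Prop := Coded {
  coded0 : known cempty (cd (fun=> 0));
  coded1 : known cempty (cd (fun=> 1));
  codedD : forall X u v, known X (cd u) -> known X (cd v) ->
    reach X ca (cd (fun i => u i + v i));
  codedB : forall X u v, known X (cd u) -> known X (cd v) ->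
    reach X ca (cd (fun i => u i - v i));
  codedM : forall X u v, known X T -> known X (cd u) -> known X (cd v) ->
    reach X cm (cd (fun i => u i * v i)) }.

Lemma coded_base : coded cempty (fun u : cell => csing u) 1 1.
Proof.
have kset X (u : cell) : known X (csing u) -> base X u by apply.
split=> [||X u v /kset Xu /kset Xv|X u v /kset Xu /kset Xv
          |X u v _ /kset Xu /kset Xv].
- by move=> _ ->; right; left.
- by move=> _ ->; right; right.
- exact: (@reach_op _ _ Add u v).
- exact: (@reach_op _ _ Defs.Sub u v).
- exact: (@reach_op _ _ Mul u v).
Qed.

Section CodedTheory.
Variables (T : cset cell) (R : I -> comNzRingType).
Variables (cd : (forall i, R i) -> cset cell) (ca cm : nat).
Hypothesis C : coded T cd ca cm.

Lemma eq_code (u v : forall i, R i) : (forall i, u i = v i) -> cd u = cd v.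
Proof. by move=> uv; congr cd; apply: functional_extensionality_dep. Qed.

Lemma known_eq X (v u : forall i, R i) :
  known X (cd v) -> (forall i, u i = v i) -> known X (cd u).
Proof. by move=> kv /eq_code ->. Qed.

Lemma reach_eq X c (v u : forall i, R i) :
  reach X c (cd v) -> (forall i, u i = v i) -> reach X c (cd u).
Proof. by move=> rv /eq_code ->. Qed.

Lemma coded_sum X n (u : nat -> forall i, R i) :
  (forall j, (j < n)%N -> known X (cd (u j))) ->
  reach X (n * ca) (cd (fun i => \sum_(j < n) u j i)).
Proof.
move=> ku; pose Y m := cd (fun i => \sum_(j < m) u j i).
have: reach X (n * ca) (cfamn n.+1 Y).
  apply: reach_iter => [|m mn].
    apply: (@known_eq _ (fun=> 0)) => [|i]; last by rewrite big_ord0.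
    exact: known_set0 (coded0 C).
  rewrite /Y (@eq_code (fun i => \sum_(j < m.+1) u j i)
    (fun i => \sum_(j < m) u j i + u m i)) => [|i];
      last by rewrite big_ord_recr.
  apply: (codedD C (u := fun i => \sum_(j < m) u j i) (v := u m));
    first exact: known_right.
  by apply: known_left; apply: ku.
by apply: reach_sub => z Yz; left; exists n => /=.
Qed.

Lemma coded_exp X (u : forall i, R i) n t :
  (n < 2 ^ t)%N -> known X T -> known X (cd u) ->
  reach X (t * (2 * cm)) (cd (fun i => u i ^+ n)).
Proof.
move=> + kT ku; elim: t n => [|t IH] n nt.
  have -> : n = 0%N by case: n nt.
  by apply: reach_known; apply: known_set0; apply: (coded1 C).
have nE : n = (n./2 + n./2 + odd n)%N by rewrite addnn addnC odd_double_half.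
have /IH rh : (n./2 < 2 ^ t)%N by rewrite -divn2 ltn_divLR // -expnSr.
rewrite mulSnr; apply: (reach_bind rh); rewrite mul2n -addnn.
apply: (@reach_bind _ _ (cd (fun i => u i ^+ (n./2 + n./2)))).
  apply: (@reach_eq _ _ (fun i => u i ^+ n./2 * u i ^+ n./2)) => [|i].
    apply: (codedM C (u := fun i => u i ^+ n./2) (v := fun i => u i ^+ n./2));
      first exact: known_left.
    - exact: known_right.
    - exact: known_right.
  by rewrite exprD.
case: (odd n) nE => nE; last first.
  rewrite addn0 in nE; rewrite -nE; apply: (reachW (leq0n _)).
  by apply: reach_known; apply: known_right.
apply: (@reach_eq _ _ (fun i => u i ^+ (n./2 + n./2) * u i)) => [|i].
  apply: (codedM C (u := fun i => u i ^+ (n./2 + n./2)));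
    first by do 2!apply: known_left.
  - exact: known_right.
  - by do 2!apply: known_left.
by rewrite -exprSr -addn1 -nE.
Qed.

(** A Montgomery ladder: the pair of indices m, m + 1 with m = n./2 gives the pair n, n + 1 by two
    doubling formulas, each one product and one subtraction. The isolated [ca] pays for the constant
    2 = 1 + 1. *)
Lemma coded_bracket X (u : forall i, R i) n t :
  (n < 2 ^ t)%N -> known X T -> known X (cd u) ->
  reach X (ca + t * (2 * cm + 2 * ca)) (cd (fun i => bracket n (u i))).
Proof.
move=> nt kT ku.
have r2 : reach X ca (cd (fun i => 2%:R)).
  apply: (@reach_eq _ _ (fun i => 1 + 1)) => [|i]; last by [].
  by apply: (codedD C (u := fun=> 1) (v := fun=> 1)); apply: known_set0;
    apply: (coded1 C).
apply: (reach_bind r2).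
have {r2} k2 := @known_right _ _ X (cd (fun i => 2%:R)).
have {}kT : known (X `|` cd (fun i => 2%:R)) T by exact: known_left.
have {}ku : known (X `|` cd (fun i => 2%:R)) (cd u) by exact: known_left.
move: (X `|` _) kT ku k2 => {}X kT ku k2.
pose Y m := cd (fun i => bracket m (u i)).
suff: reach X (t * (2 * cm + 2 * ca)) (Y n `|` Y n.+1).
  by apply: reach_sub => z; left; left.
elim: t n nt => [|t IH] n nt.
  have -> : n = 0%N by case: n nt.
  by apply: reach_known; apply: knownU.
have /IH rh : (n./2 < 2 ^ t)%N by rewrite -divn2 ltn_divLR // -expnSr.
rewrite mulSnr; apply: (reach_bind rh).
set m := n./2; set X' := X `|` _.
have [kT' ku' k2' km km1] : [/\ known X' T, known X' (cd u),
    known X' (cd (fun i => 2%:R)), known X' (Y m) & known X' (Y m.+1)].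
  split; try exact: known_left.
  - by move=> z Yz; left; right; left.
  - by move=> z Yz; left; right; right.
have sqr j : known X' (Y j) -> reach X' (cm + ca) (Y j.*2).
  move=> kj; apply: (@reach_bind _ _ (cd (fun i => bracket j (u i) * bracket j
    (u i)))).
    exact: (codedM C (u := fun i => bracket j (u i))
      (v := fun i => bracket j (u i))).
  apply: (@reach_eq _ _ (fun i => bracket j (u i) * bracket j (u i) - 2%:R)) =>
    [|i].
    by apply: (codedB C (u := fun i => bracket j (u i) * bracket j (u i))
      (v := fun=> 2%:R)); [exact: known_right | exact: known_left].
  by have [-> _] := bracket_double j (u i).
have mul : reach X' (cm + ca) (Y m.*2.+1).
  apply: (@reach_bind _ _ (cd (fun i => bracket m (u i) * bracket m.+1 (u i)))).
    exact: (codedM C (u := fun i => bracket m (u i))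
      (v := fun i => bracket m.+1 (u i))).
  apply: (@reach_eq _ _ (fun i => bracket m (u i) * bracket m.+1 (u i) - u i))
    => [|i].
    by apply: (codedB C (u := fun i => bracket m (u i) * bracket m.+1 (u i)));
      [exact: known_right | exact: known_left].
  by have [_ ->] := bracket_double m (u i).
have -> : (2 * cm + 2 * ca = cm + ca + (cm + ca))%N by ring.
have := odd_double_half n; rewrite -/m.
case: (odd n) => <-; last by rewrite add0n; apply: reachU mul; apply: sqr.
by rewrite add1n -doubleS; apply: reachU mul _; apply: sqr.
Qed.

(** All indices j are included: the coefficients beyond the size are zeros, which are free.
    Truncations and shifts then cost nothing, and no degree has to be tracked in the encoding. *)
Definition pcode (p : forall i, {poly R i}) : cset cell :=
  cfam (fun j => cd (fun i => (p i)`_j)).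

Lemma pcode_known X (p : forall i, {poly R i}) :
  known X (pcode p) <-> forall j, known X (cd (fun i => (p i)`_j)).
Proof.
split=> [kp j z pz|kp z [j] ]; first by apply: kp; exists j.
exact: kp.
Qed.

Lemma eq_pcode (p p' : forall i, {poly R i}) :
  (forall i, p i = p' i) -> pcode p = pcode p'.
Proof. by move=> pp'; congr pcode; apply: functional_extensionality_dep. Qed.

Lemma pcode_coef_known X (p : forall i, {poly R i}) (j : nat) :
  known X (pcode p) -> known X (cd (fun i => (p i)`_j)).
Proof. by move=> /pcode_known. Qed.

Lemma pcode_reach X c n (p : forall i, {poly R i}) :
  (forall i, (size (p i) <= n)%N) ->
  (forall j, (j < n)%N -> reach X c (cd (fun i => (p i)`_j))) ->
  reach X (n * c) (pcode p).
Proof.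
move=> sp rp; apply: reach_sub (reach_bigcup rp); apply/pcode_known => j.
have [jn|nj] := ltnP j n; first by move=> z pz; left; exists j.
apply: known_set0; apply: (@known_eq _ (fun=> 0)) => [|i].
  exact: (coded0 C).
by rewrite nth_default // (leq_trans (sp i) nj).
Qed.

Lemma pcodeD X n (p p' : forall i, {poly R i}) :
  (forall i, (size (p i) <= n)%N) -> (forall i, (size (p' i) <= n)%N) ->
  known X (pcode p) -> known X (pcode p') ->
  reach X (n * ca) (pcode (fun i => p i + p' i)).
Proof.
move=> sp sp' kp kp'; apply: pcode_reach => [i|j jn].
  by rewrite (leq_trans (size_polyD _ _)) // geq_max sp sp'.
apply: (@reach_eq _ _ (fun i => (p i)`_j + (p' i)`_j)) => [|i].
  by apply: (codedD C (u := fun i => (p i)`_j) (v := fun i => (p' i)`_j));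
    apply: pcode_coef_known.
by rewrite coefD.
Qed.

Lemma pcodeB X n (p p' : forall i, {poly R i}) :
  (forall i, (size (p i) <= n)%N) -> (forall i, (size (p' i) <= n)%N) ->
  known X (pcode p) -> known X (pcode p') ->
  reach X (n * ca) (pcode (fun i => p i - p' i)).
Proof.
move=> sp sp' kp kp'; apply: pcode_reach => [i|j jn].
  by rewrite (leq_trans (size_polyD _ _)) // geq_max size_polyN sp sp'.
apply: (@reach_eq _ _ (fun i => (p i)`_j - (p' i)`_j)) => [|i].
  by apply: (codedB C (u := fun i => (p i)`_j) (v := fun i => (p' i)`_j));
    apply: pcode_coef_known.
by rewrite coefB.
Qed.

Lemma pcode_const X (u : forall i, R i) :
  known X (cd u) -> known X (pcode (fun i => (u i)%:P)).
Proof.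
move=> ku; apply/pcode_known => -[|j].
  by apply: (@known_eq _ u) => // i; rewrite coefC.
apply: known_set0; apply: (@known_eq _ (fun=> 0)) => [|i];
  last by rewrite coefC.
exact: (coded0 C).
Qed.

Lemma pcode_take X n (p : forall i, {poly R i}) :
  known X (pcode p) -> known X (pcode (fun i => take_poly n (p i))).
Proof.
move=> kp; apply/pcode_known => j; have [jn|nj] := ltnP j n.
  apply: (@known_eq _ (fun i => (p i)`_j)) => [|i]; last first.
    by rewrite coef_take_poly jn.
  exact: pcode_coef_known.
apply: known_set0; apply: (@known_eq _ (fun=> 0)) => [|i].
  exact: (coded0 C).
by rewrite coef_take_poly ltnNge nj.
Qed.

Lemma pcode_drop X n (p : forall i, {poly R i}) :
  known X (pcode p) -> known X (pcode (fun i => drop_poly n (p i))).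
Proof.
move=> kp; apply/pcode_known => j.
apply: (@known_eq _ (fun i => (p i)`_(j + n))) => [|i].
  exact: pcode_coef_known.
by rewrite coef_drop_poly.
Qed.

End CodedTheory.

End Coded.

(** * Barrett's division *)

Section Barrett.
Variables (K : fieldType) (n : nat) (phi : {poly K}).
Hypotheses (n_gt0 : (0 < n)%N) (size_phi : (size phi <= n)%N).
Local Notation f := ('X^n - phi).
Local Notation g := ('X^((2 * n).-1) %/ f).

Lemma size_modulus : size f = n.+1.
Proof. by rewrite size_polyDl ?size_polyXn // size_polyN ltnS. Qed.

Lemma monic_modulus : f \is monic.
Proof.
by rewrite monicE lead_coefDl ?lead_coefXn // size_polyN size_polyXn ltnS.
Qed.

Lemma modulus_neq0 : f != 0.
Proof. exact: monic_neq0 monic_modulus. Qed.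

Lemma size_mod_modulus (c : {poly K}) : (size (c %% f)%R <= n)%N.
Proof. by rewrite -ltnS -size_modulus ltn_modp modulus_neq0. Qed.

Lemma size_barrett_inverse : (size g <= n)%N.
Proof.
rewrite size_divp ?modulus_neq0 // size_modulus size_polyXn.
by rewrite prednK ?muln_gt0 // mul2n -addnn addnK.
Qed.

(* With c1 = c div X^n and u = c1 g div X^(n-1), X^(n-1) (c - u f) has size at
   most 2n - 1, so that u is the quotient of c by f. *)
Lemma barrett (c : {poly K}) : (size c <= (2 * n).-1)%N ->
  c %% f = take_poly n c
    + take_poly n (drop_poly n.-1 (drop_poly n c * g) * phi).
Proof.
move=> size_c; set c1 := drop_poly n c; set u := drop_poly n.-1 (c1 * g).
have size_c1 : (size c1 <= n.-1)%N by rewrite size_drop_poly; lia.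
have cE : c = take_poly n c + c1 * 'X^n by rewrite poly_take_drop.
have uE : u * 'X^(n.-1) = c1 * g - take_poly n.-1 (c1 * g).
  by apply/esym/(canLR (addrK _)); rewrite [RHS]addrC poly_take_drop.
have gE : g * f = 'X^((2 * n).-1) - 'X^((2 * n).-1) %% f.
  by rewrite {2}(divp_eq 'X^((2 * n).-1) f) addrK.
have nE : 'X^((2 * n).-1) = 'X^n * 'X^(n.-1) :> {poly K}.
  by rewrite -exprD; congr ('X^_); lia.
have dE : (c - u * f) * 'X^(n.-1) = take_poly n c * 'X^(n.-1)
    + c1 * ('X^((2 * n).-1) %% f) + take_poly n.-1 (c1 * g) * f.
  rewrite mulrBl mulrAC uE mulrBl -mulrA gE {1}cE nE.
  by ring.
have size_d : (size (c - u * f)%R <= n)%N.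
  have [->|d_neq0] := eqVneq (c - u * f) 0; first by rewrite size_poly0.
  have : (size ((c - u * f) * 'X^(n.-1))%R <= (2 * n).-1)%N.
    have sM (a b : {poly K}) m m' : (size a <= m)%N -> (size b <= m')%N ->
        (size (a * b)%R <= (m + m').-1)%N.
      move=> sa sb; apply: leq_trans (size_polyMleq _ _) _.
      by have := leq_add sa sb; lia.
    rewrite dE (leq_trans (size_polyD _ _)) // geq_max; apply/andP; split.
      rewrite (leq_trans (size_polyD _ _)) // geq_max; apply/andP; split.
        apply: leq_trans (sM _ _ _ _ (size_take_poly n c) (leqnn _)) _.
        by rewrite size_polyXn; lia.
      by apply: leq_trans (sM _ _ _ _ size_c1 (size_mod_modulus _)) _; lia.
    apply: leq_trans (sM _ _ _ _ (size_take_poly _ _) (leqnn _)) _.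
    by rewrite size_modulus; lia.
  by rewrite size_mulXn //; lia.
have -> : c %% f = c - u * f.
  rewrite -[in LHS](subrK (u * f) c) addrC.
  by rewrite modp_addl_mul_small // size_modulus ltnS.
(* Modulo X^n the modulus is [- phi], so the remainder c - u f is the truncation of c + u phi. *)
rewrite -[LHS](take_poly_id size_d).
have -> : c - u * f = c + u * phi + - u * 'X^n by ring.
by rewrite take_polyD take_polyMXn_0 addr0 take_polyD.
Qed.

Lemma mod_modulus1 : 1 %% f = 1.
Proof. by rewrite modp_small // size_poly1 size_modulus ltnS. Qed.

(** One step of long division: multiplying the remainder by X moves its top coefficient a to degree
    n, where a X^n is a f + a phi; so a enters the quotient and [a *: phi] the remainder. *)
Lemma modulus_rem_step t (a := ('X^t %% f)`_n.-1) :
  'X^(t.+1) %/ f = ('X^t %/ f) * 'X + a%:P /\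
  'X^(t.+1) %% f = take_poly n.-1 ('X^t %% f) * 'X + a *: phi.
Proof.
set rho := 'X^t %% f; set G := 'X^t %/ f.
have XtE : 'X^t = G * f + rho by rewrite -divp_eq.
have rhoE : rho = take_poly n.-1 rho + a *: 'X^(n.-1).
  apply/polyP => i; rewrite coefD coef_take_poly coefZ coefXn.
  have [in1|ni] := ltnP i n.-1; first by rewrite ltn_eqF // mulr0 addr0.
  have [->|i_neq] := eqVneq i n.-1; first by rewrite mulr1 add0r.
  rewrite mulr0 addr0 nth_default // (leq_trans (size_mod_modulus _)) //.
  by lia.
have [||<- <-] // := @divp_modpP K 'X^(t.+1) (G * 'X + a%:P) f
  (take_poly n.-1 rho * 'X + a *: phi).
  rewrite exprSr XtE mulrDl {1}rhoE.
  have -> : a *: 'X^(n.-1) = a%:P * 'X^(n.-1) by rewrite mul_polyC.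
  have -> : 'X^n = 'X^(n.-1) * 'X :> {poly K} by rewrite -exprSr prednK.
  by rewrite -!mul_polyC; ring.
rewrite size_modulus ltnS (leq_trans (size_polyD _ _)) // geq_max.
rewrite (leq_trans (size_scale_leq _ _)) // andbT.
apply: leq_trans (size_polyMleq _ _) _; rewrite size_polyX addn2 /=.
by rewrite -(prednK n_gt0) ltnS size_take_poly.
Qed.

(** The coefficients of the quotient are the top coefficients of the successive remainders, hence
    free once these are computed. *)
Lemma coef_barrett_quotient t j :
  ('X^t %/ f)`_j
  = if (j < t)%N then ('X^(t.-1 - j) %% f)`_n.-1 else 0.
Proof.
elim: t j => [|t IH] j.
  by rewrite divp_small ?coef0 // size_poly1 size_modulus ltnS.
have [-> _] := modulus_rem_step t; rewrite coefD coefMX coefC.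
case: j => [|j] /=; first by rewrite add0r subn0.
by rewrite addr0 IH ltnS; case: t {IH} => // t; rewrite subSS.
Qed.

End Barrett.

Section CodedBarrett.
Local Open Scope cset_scope.
Variables (F : fieldType) (I : Type) (T : cset (I -> F)).
Variables (R : I -> fieldType) (cd : (forall i, R i) -> cset (I -> F)).
Variables (ca cm pm n : nat) (phi : forall i, {poly R i}).
Hypothesis C : coded T (R := R) cd ca cm.
Hypotheses (n_gt0 : (0 < n)%N) (size_phi : forall i, (size (phi i) <= n)%N).
Implicit Types p c : forall i, {poly R i}.

Hypothesis polyM : forall X p p', known X T ->
  (forall i, (size (p i) <= n)%N) -> (forall i, (size (p' i) <= n)%N) ->
  known X (pcode cd p) -> known X (pcode cd p') ->
  reach X pm (pcode cd (fun i => p i * p' i)).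

Let f i := 'X^n - phi i.
(** Up to reversal of the coefficients, this is the power series inverse of the reversed modulus,
    truncated to n terms. *)
Definition barrett_inverse i := 'X^((2 * n).-1) %/ f i.

(** Schoolbook: 2n remainders of powers of X, each of n coefficients, at one product and one
    addition per coefficient. *)
Lemma reach_barrett_inverse X : known X T -> known X (pcode cd phi) ->
  reach X (2 * n * (n * (cm + ca))) (pcode cd barrett_inverse).
Proof.
move=> kT kphi; pose Y t := pcode cd (fun i => 'X^t %% f i).
have rY : reach X (2 * n * (n * (cm + ca))) (cfamn (2 * n).+1 Y).
  apply: reach_iter => [|t _].
    have -> : Y 0%N = pcode cd (fun=> 1).
      by apply: eq_pcode => i; rewrite mod_modulus1.
    have -> : pcode cd (fun=> 1) = pcode cd (fun i => (1 : R i)%:P).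
      by apply: eq_pcode.
    by apply: (pcode_const C); apply: known_set0; apply: (coded1 C).
  apply: (pcode_reach C) => [i|j jn]; first exact: size_mod_modulus.
  have kY : known (X `|` Y t) (Y t) by apply: known_right.
  have kn1 := pcode_coef_known (j := n.-1) kY.
  have kp := pcode_coef_known (j := j) (@known_left _ _ X (Y t) _ kphi).
  apply: (@reach_bind _ _
    (cd (fun i => ('X^t %% f i)`_n.-1 * (phi i)`_j))).
    exact: (codedM C (u := fun i => ('X^t %% f i)`_n.-1)
      (v := fun i => (phi i)`_j) (@known_left _ _ X (Y t) _ kT) kn1 kp).
  apply: (@reach_eq _ _ _ _ _ _ (fun i =>
      (if j is j'.+1 then ('X^t %% f i)`_j' else 0)
      + ('X^t %% f i)`_n.-1 * (phi i)`_j)) => [|i]; last first.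
    have [_ ->] := modulus_rem_step n_gt0 (size_phi i) t.
    rewrite coefD coefMX coefZ; case: j jn {kp} => [|j] //= jn.
    by rewrite coef_take_poly ifT // -ltnS prednK.
  apply: (codedD C (u := fun i => if j is j'.+1 then ('X^t %% f i)`_j' else 0)
    (v := fun i => ('X^t %% f i)`_n.-1 * (phi i)`_j)); last exact: known_right.
  apply: known_left; case: j {jn kp} => [|j].
    by apply: known_set0; apply: (coded0 C).
  exact: pcode_coef_known kY.
apply: reach_sub rY; apply/pcode_known => j.
have [jn|nj] := ltnP j (2 * n).-1.
  apply: (@known_eq _ _ _ _ _ (fun i => ('X^((2 * n).-2 - j) %% f i)`_n.-1)).
    apply: pcode_coef_known => z Yz; left; exists ((2 * n).-2 - j)%N => //=.
    by lia.
  by move=> i; rewrite coef_barrett_quotient // jn.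
apply: known_set0; apply: (@known_eq _ _ _ _ _ (fun=> 0)) => [|i].
  exact: (coded0 C).
by rewrite coef_barrett_quotient // ltnNge nj.
Qed.

Lemma reach_barrett X c : known X T -> known X (pcode cd phi) ->
  known X (pcode cd barrett_inverse) ->
  (forall i, (size (c i) <= (2 * n).-1)%N) -> known X (pcode cd c) ->
  reach X (2 * pm + n * ca) (pcode cd (fun i => c i %% f i)).
Proof.
move=> kT kphi kg sc kc.
pose c1 i := drop_poly n (c i); pose w i := c1 i * barrett_inverse i.
pose u i := drop_poly n.-1 (w i); pose v i := u i * phi i.
have sc1 i : (size (c1 i) <= n.-1)%N.
  by rewrite size_drop_poly; have := sc i; lia.
have sg i : (size (barrett_inverse i) <= n)%N by apply: size_barrett_inverse.
rewrite mul2n -addnn -addnA; apply: (@reach_bind _ _ (pcode cd w)).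
  apply: polyM => // [i|]; first by rewrite (leq_trans (sc1 i)) ?leq_pred.
  exact: pcode_drop.
apply: (@reach_bind _ _ (pcode cd v)).
  apply: polyM => [|i|//||]; try exact: known_left.
    rewrite size_drop_poly.
    move: (size_polyMleq (c1 i) (barrett_inverse i)) (sc1 i) (sg i).
    rewrite -/(w i).
    move: (size (w i)) (size (c1 i)) (size (barrett_inverse i)) => a b d; lia.
  by apply: (pcode_drop (n := n.-1) (p := w)); apply: known_right.
have -> : pcode cd (fun i => c i %% f i)
    = pcode cd (fun i => take_poly n (c i) + take_poly n (v i)).
  by apply: eq_pcode => i; rewrite barrett.
apply: (pcodeD C) => [i|i||]; try exact: size_take_poly.
- by apply: (pcode_take C); do 2!apply: known_left.
- by apply: (pcode_take C); apply: known_right.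
Qed.

(** Stated for an abstract ring [Q] with representatives, so as to apply at both levels of the
    tower, to k over F_q and to k' over k. The three [pm] are the product itself and the two
    products of Barrett's division. *)
Lemma coded_quotient (Q : I -> comNzRingType) (rep : forall i, Q i -> {poly R
  i}) :
  (forall i, rep i 0 = 0) -> (forall i, rep i 1 = 1) ->
  (forall i a, (size (rep i a) <= n)%N) ->
  (forall i a b, rep i (a + b) = rep i a + rep i b) ->
  (forall i a b, rep i (a - b) = rep i a - rep i b) ->
  (forall i a b, rep i (a * b) = (rep i a * rep i b) %% f i) ->
  coded (T `|` pcode cd phi `|` pcode cd barrett_inverse) (R := Q)
    (fun u => pcode cd (fun i => rep i (u i))) (n * ca) (3 * pm + n * ca).
Proof.
move=> rep0 rep1 srep repD repB repM.
split=> [||X u v ku kv|X u v ku kv|X u v kT ku kv].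
- have -> : pcode cd (fun i => rep i 0) = pcode cd (fun i => (0 : R i)%:P).
    by apply: eq_pcode => i; rewrite rep0.
  exact: (pcode_const C (coded0 C)).
- have -> : pcode cd (fun i => rep i 1) = pcode cd (fun i => (1 : R i)%:P).
    by apply: eq_pcode => i; rewrite rep1.
  exact: (pcode_const C (coded1 C)).
- have -> : pcode cd (fun i => rep i (u i + v i))
      = pcode cd (fun i => rep i (u i) + rep i (v i)).
    by apply: eq_pcode => i; rewrite repD.
  apply: (pcodeD C (p := fun i => rep i (u i)) (p' := fun i => rep i (v i))) =>
    // i; exact: srep.
- have -> : pcode cd (fun i => rep i (u i - v i))
      = pcode cd (fun i => rep i (u i) - rep i (v i)).
    by apply: eq_pcode => i; rewrite repB.
  apply: (pcodeB C (p := fun i => rep i (u i)) (p' := fun i => rep i (v i))) =>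
    // i; exact: srep.
pose w i := rep i (u i) * rep i (v i).
rewrite mulSn -addnA; apply: (@reach_bind _ _ (pcode cd w)).
  by apply: polyM => //; apply: known_sub kT => z ?; left; left.
have {}kT : known (X `|` pcode cd w)
  (T `|` pcode cd phi `|` pcode cd barrett_inverse) by exact: known_left.
have -> : pcode cd (fun i => rep i (u i * v i)) = pcode cd (fun i => w i %% f
  i).
  by apply: eq_pcode => i; rewrite repM.
apply: reach_barrett.
- by apply: known_sub kT => z ?; left; left.
- by apply: known_sub kT => z ?; left; right.
- by apply: known_sub kT => z ?; right.
- move=> i; apply: leq_trans (size_polyMleq _ _) _.
  by have := srep i (u i); have := srep i (v i); lia.
- exact: known_right.
Qed.

End CodedBarrett.

(** * Kronecker substitution *)

(** Slots of width w do not overlap, so quotient and remainder of the exponent by w are the outer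
    and the inner index. *)
Lemma coef_horner_Xn (F : fieldType) (w : nat) (P : {poly {poly F}}) m :
  (0 < w)%N -> (forall j, (size (P`_j)%R <= w)%N) ->
  P.['X^w]`_m = P`_(m %/ w)`_(m %% w).
Proof.
move=> w_gt0 sP; rewrite horner_coef coef_sum.
have termE j : (P`_j * 'X^w ^+ j)`_m = if j == (m %/ w)%N then P`_j`_(m %% w)
  else 0.
  rewrite -exprM coefMXn mulnC; case: eqP => [->|/eqP j_neq].
    by rewrite ltnNge leq_divM {2}(divn_eq m w) addKn.
  case: ltnP => // le_m; apply: nth_default; apply: leq_trans (sP j) _.
  have jm : (j < m %/ w)%N by rewrite ltn_neqAle j_neq leq_divRL.
  by move: jm; rewrite leq_divRL // mulSn; lia.
rewrite (eq_bigr (fun j : 'I__ => if (j : nat) == (m %/ w)%N then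
  P`_(m %/ w)`_(m %% w) else 0)) => [|j _]; last first.
  by rewrite termE; case: eqP => // ->.
have [lt|ge] := ltnP (m %/ w) (size P); last first.
  by rewrite [P`_(_ %/ _)]nth_default // coef0 big1 // => j _; case: ifP.
rewrite (bigD1 (Ordinal lt)) //= eqxx big1 ?addr0 // => j.
by rewrite -val_eqE /= => /negPf ->.
Qed.

Lemma size_horner_Xn (F : fieldType) (w n : nat) (P : {poly {poly F}}) :
  (0 < w)%N -> (forall j, (size (P`_j)%R <= w)%N) -> (size P <= n)%N ->
  (size (P.['X^w])%R <= w * n)%N.
Proof.
move=> w_gt0 sP sn; apply/leq_sizeP => m le_m.
by rewrite coef_horner_Xn // [P`_(_ %/ _)]nth_default ?coef0 //
  (leq_trans sn) // leq_divRL // mulnC.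
Qed.

Section Kronecker.
Local Open Scope cset_scope.
Variables (F : fieldType) (I : Type) (r s : nat).
Variables (K : I -> fieldType) (rep : forall i, K i -> {poly F}).
Arguments rep : clear implicits.
Variables (phi : I -> {poly F}) (Mc : nat -> nat).
Hypotheses (r_gt0 : (0 < r)%N) (s_gt0 : (0 < s)%N).
Hypothesis size_phi : forall i, (size (phi i) <= r)%N.
Hypothesis rep0 : forall i, rep i 0 = 0.
Hypothesis rep1 : forall i, rep i 1 = 1.
Hypothesis size_rep : forall i a, (size (rep i a) <= r)%N.
Hypothesis repD : forall i a b, rep i (a + b) = rep i a + rep i b.
Hypothesis repB : forall i a b, rep i (a - b) = rep i a - rep i b.
Hypothesis repM : forall i a b,
  rep i (a * b) = (rep i a * rep i b) %% ('X^r - phi i).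

Local Notation cdF := (fun u : I -> F => csing u).
Local Notation cdK := (fun u : forall i, K i => pcode cdF (fun i => rep i (u
  i))).
Local Notation g := (barrett_inverse (R := fun=> F) r phi).

Hypothesis polyMF : forall m X (p p' : I -> {poly F}), (0 < m)%N ->
  (forall i, (size (p i) <= m)%N) -> (forall i, (size (p' i) <= m)%N) ->
  known X (pcode (R := fun=> F) cdF p) ->
  known X (pcode (R := fun=> F) cdF p') ->
  reach X (Mc m) (pcode (R := fun=> F) cdF (fun i => p i * p' i)).

Lemma coded_kronecker :
  coded (cempty `|` pcode (R := fun=> F) cdF phi `|` pcode (R := fun=> F) cdF g)
    (R := K) cdK (r * 1) (3 * Mc r + r * 1).
Proof.
apply: (@coded_quotient F I cempty (fun=> F) cdF 1 1 (Mc r) r phi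
  (coded_base F I) r_gt0 size_phi _ K rep) => //.
by move=> X p p' _ sp sp' kp kp'; apply: polyMF.
Qed.

(** Products of coefficients are summed unreduced: a sum of products of two polynomials of size at
    most r has size at most 2r - 1 and fits in a slot of width 2r. One product of size 2rs thus
    yields all the coefficients, at most 2s of them, each of which is reduced once. Packing and
    unpacking only rename cells. *)
Lemma reach_kronecker X (p p' : forall i, {poly K i}) :
  known X (cempty `|` pcode (R := fun=> F) cdF phi `|` pcode (R := fun=> F) cdF
    g) ->
  (forall i, (size (p i) <= s)%N) -> (forall i, (size (p' i) <= s)%N) ->
  known X (pcode cdK p) -> known X (pcode cdK p') ->
  reach X (Mc (2 * r * s) + 2 * s * (2 * Mc r + r))
    (pcode cdK (fun i => p i * p' i)).
Proof.
move=> kT sp sp' kp kp'; pose w := (2 * r)%N.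
have w_gt0 : (0 < w)%N by rewrite muln_gt0.
pose lft (p : forall i, {poly K i}) i := map_poly (rep i) (p i).
have lftE (q : forall i, {poly K i}) i j : (lft q i)`_j = rep i (q i)`_j.
  by rewrite coef_map_id0.
have slft (q : forall i, {poly K i}) i j : (size ((lft q i)`_j)%R <= w)%N.
  by rewrite lftE (leq_trans (size_rep _)) // leq_pmull.
have pack (q : forall i, {poly K i}) : (forall i, (size (q i) <= s)%N) -> known
  X (pcode cdK q) ->
    (forall i, (size ((lft q i).['X^w])%R <= w * s)%N) /\
    known X (pcode (R := fun=> F) cdF (fun i => (lft q i).['X^w])).
  move=> sq kq; split=> [i|].
    apply: size_horner_Xn => //.
    by rewrite (leq_trans (size_poly _ _)).
  apply/pcode_known => m.
  apply: (@known_eq _ _ (fun=> F) cdF _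
      (fun i => (rep i (q i)`_(m %/ w))`_(m %% w))) => [|i].
    apply: (pcode_coef_known (R := fun=> F) (cd := cdF) (j := (m %% w)%N)
      (p := fun i => rep i (q i)`_(m %/ w))).
    exact: (pcode_coef_known (cd := cdK)).
  by rewrite coef_horner_Xn // lftE.
have [sP kP] := pack p sp kp; have [sP' kP'] := pack p' sp' kp'.
pose W i := lft p i * lft p' i.
have WE i : (lft p i).['X^w] * (lft p' i).['X^w] = (W i).['X^w].
  by rewrite hornerM.
have coefW i m : (W i)`_m = \sum_(j < m.+1) rep i (p i)`_j * rep i (p' i)`_(m -
  j).
  by rewrite coefM; apply: eq_bigr => j _; rewrite !lftE.
have sW i m : (size ((W i)`_m)%R <= (2 * r).-1)%N.
  rewrite coefW; apply: (leq_trans (size_sum _ _ _)); apply/bigmax_leqP => j _.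
  apply: leq_trans (size_polyMleq _ _) _.
  have := size_rep (p i)`_j; have := size_rep (p' i)`_(m - j); lia.
apply: (@reach_bind _ _ (pcode (R := fun=> F) cdF (fun i => (W i).['X^w]))).
  apply: reach_sub (polyMF _ sP sP' kP kP'); last by rewrite muln_gt0 w_gt0.
  rewrite (@eq_pcode _ _ (fun=> F) _ (fun i => (W i).['X^w])
    (fun i => (lft p i).['X^w] * (lft p' i).['X^w])) => [|i];
      last by rewrite WE.
  exact: known_refl.
set X' := X `|` _; have {}kT := @known_left _ _ X _ _ kT : known X' _.
apply: (pcode_reach coded_kronecker) => [i|m _].
  apply: leq_trans (size_polyMleq _ _) _.
  apply: leq_trans (leq_pred _) _; rewrite mul2n -addnn.
  exact: leq_add (sp i) (sp' i).
have -> : pcode (R := fun=> F) cdF (fun i => rep i (p i * p' i)`_m)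
    = pcode (R := fun=> F) cdF (fun i => (W i)`_m %% ('X^r - phi i)).
  apply: eq_pcode => i; rewrite coefM coefW.
  pose modf (c : {poly F}) := c %% ('X^r - phi i).
  (* Reduction modulo the modulus of k is additive, so it may be performed after the summation. *)
  rewrite (big_morph (rep i) (@repD i) (@rep0 i)).
  rewrite -[RHS]/(modf _) (big_morph modf (fun a b => modpD _ a b) (mod0p _)).
  by apply: eq_bigr => j _; rewrite repM.
rewrite -[X in (_ + X)%N]muln1.
apply: (reach_barrett (R := fun=> F) (coded_base F I)) => //.
- by move=> Z q q' _ sq sq' kq kq'; apply: polyMF.
- by apply: known_sub kT => z ?; left; right.
- by apply: known_sub kT => z ?; right.
apply/pcode_known => l; have [lw|wl] := ltnP l w; last first.
  apply: known_set0; apply: (@known_eq _ _ (fun=> F) cdF _ (fun=> 0)) => [|i].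
    exact: (coded0 (coded_base F I)).
  by rewrite nth_default // (leq_trans (sW i m)) // (leq_trans (leq_pred _)).
apply: (@known_eq _ _ (fun=> F) cdF _ (fun i => (W i).['X^w]`_(w * m + l))) =>
  [|i].
  apply: (pcode_coef_known (R := fun=> F) (cd := cdF) (p := fun i => (W
    i).['X^w])).
  exact: known_right.
rewrite coef_horner_Xn // => [|j];
  last by rewrite (leq_trans (sW i j)) ?leq_pred.
by rewrite mulnC divnMDl // divn_small // addn0 modnMDl modn_small.
Qed.

End Kronecker.

(** * The trace to k *)

Section PcharPower.
Variables (R : comNzRingType) (p : nat).
Hypothesis pR : p \in [pchar R].

Lemma exprD_pchar_pow m (x y : R) : (x + y) ^+ (p ^ m) = x ^+ (p ^ m) + y ^+ (p
  ^ m).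
Proof.
by rewrite exprDn_pchar // pnatX pnatE ?(pcharf_prime pR) // pR.
Qed.

Lemma expr_sum_pchar_pow m (J : Type) (s : seq J) (P : pred J) (u : J -> R) :
  (\sum_(j <- s | P j) u j) ^+ (p ^ m) = \sum_(j <- s | P j) u j ^+ (p ^ m).
Proof.
pose frob (x : R) := x ^+ (p ^ m).
rewrite -[LHS]/(frob _) (@big_morph _ _ frob 0 +%R 0 +%R (exprD_pchar_pow m))
  //.
by rewrite /frob expr0n expn_eq0 -leqn0 leqNgt prime_gt0 ?(pcharf_prime pR).
Qed.

End PcharPower.

Lemma bracket_rmorph (K L : nzRingType) (f : {rmorphism K -> L}) n t :
  f (bracket n t) = bracket n (f t).
Proof.
elim/ltn_ind: n => -[|[|n] ] IH //; first exact: rmorph_nat.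
rewrite -[bracket n.+2 t]/(t * bracket n.+1 t - bracket n t).
by rewrite rmorphB rmorphM !IH.
Qed.

Lemma bracket_inv (K : comNzRingType) n (x y : K) :
  x * y = 1 -> bracket n (x + y) = x ^+ n + y ^+ n.
Proof.
move=> xy; elim/ltn_ind: n => -[|[|n] ] IH //.
rewrite -[LHS]/((x + y) * bracket n.+1 (x + y) - bracket n (x + y)).
rewrite !IH //.
have -> : x ^+ n.+2 + y ^+ n.+2
    = (x + y) * (x ^+ n.+1 + y ^+ n.+1) - x * y * (x ^+ n + y ^+ n).
  by rewrite !exprS; ring.
by rewrite xy mul1r.
Qed.

Section QuoTrace.
Variables (K : finFieldType) (p e : nat) (h : {poly K}).
Hypotheses (p_pr : prime p) (cardK : #|K| = (p ^ e)%N).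
Hypothesis hI : irreducible_poly h.
Local Notation L := (quo hI).
Local Notation n := (size h).-1.

Lemma size_monicize : size (monicize h) = size h.
Proof.
rewrite size_scale // invr_eq0 lead_coef_eq0 -size_poly_eq0.
by have [] := hI; case: size.
Qed.

Lemma mk_monic_monicize : mk_monic (monicize h) = monicize h.
Proof. exact: mk_monicE (monicize_irreducible hI). Qed.

Lemma degree_gt0 : (0 < n)%N.
Proof. by have [] := hI; case: size => [|[] ]. Qed.

Lemma card_quo : #|{: L}| = (#|K| ^ n)%N.
Proof. by rewrite card_qfpoly size_monicize. Qed.

Lemma size_quo (a : L) : (size (a : {poly K}) <= n)%N.
Proof.
have sE : size (mk_monic (monicize h)) = size h.
  by rewrite mk_monic_monicize size_monicize.
have := leq_trans (size_mk_monic a) (eq_leq sE).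
by case: (size h) degree_gt0.
Qed.

Lemma pchar_quo : p \in [pchar L].
Proof.
by rewrite (pchar_qpoly (monicize h)); apply: card_finPcharP cardK p_pr.
Qed.

Lemma quo_expand (a : L) :
  a = \sum_(i < n) (a : {poly K})`_i *: ('qX : {poly %/ monicize h}) ^+ i.
Proof.
pose inq := in_qpoly (monicize h).
have {1}-> : a = inq (a : {poly K}).
  by apply: val_inj; apply/esym/in_qpoly_small; apply: size_mk_monic.
rewrite -[X in inq X](take_poly_id (size_quo a)) /take_poly poly_def.
rewrite /inq linear_sum; apply: eq_bigr => i _ /=.
by rewrite linearZ /= rmorphXn.
Qed.

Lemma expr_card_algr m (c : K) : (c%:A : L) ^+ (#|K| ^ m) = c%:A.
Proof.
have cm : c ^+ (#|K| ^ m) = c.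
  by elim: m => [|m IH]; rewrite ?expr1 // expnSr exprM IH expf_card.
by rewrite -[c%:A]/(in_alg L c) -rmorphXn cm.
Qed.

Lemma frobenius_expand m (a : L) : a ^+ (#|K| ^ m)
  = \sum_(i < n) (a : {poly K})`_i *: (('qX : {poly %/ monicize h}) : L) ^+
    (#|K| ^ m * i).
Proof.
rewrite {1}[a]quo_expand.
have -> : (#|K| ^ m = p ^ (e * m))%N by rewrite cardK expnM.
rewrite (expr_sum_pchar_pow pchar_quo); apply: eq_bigr => i _.
rewrite -mulr_algl exprMn expnM -cardK expr_card_algr mulr_algl.
by rewrite -exprM mulnC.
Qed.

(** Two equal conjugates of Z would make a Frobenius power of exponent d < n fix Z, hence the whole
    field; then X^(#|K|^d) - X would have more roots than its degree. This makes the Vandermonde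
    matrix of the conjugates invertible. *)
Lemma frobenius_qX_inj i j : (i < j < n)%N ->
  (('qX : {poly %/ monicize h}) : L) ^+ (#|K| ^ i)
  != (('qX : {poly %/ monicize h}) : L) ^+ (#|K| ^ j).
Proof.
move=> /andP[ij jn]; apply/negP => /eqP.
pose z : L := ('qX : {poly %/ monicize h}); rewrite -/z => eq_z.
have zn : z ^+ (#|K| ^ n) = z by rewrite -card_quo expf_card.
(* Raise the equality to the power [#|K| ^ (n - j)]: its right side becomes z. *)
pose d := (n - j + i)%N.
have zd : z ^+ (#|K| ^ d) = z.
  by rewrite /d addnC expnD exprM eq_z -exprM -expnD subnKC // ltnW.
have dn : (d < n)%N by rewrite /d; lia.
have d_gt0 : (0 < d)%N by rewrite /d; lia.
have fixd (a : L) : a ^+ (#|K| ^ d) = a.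
  rewrite frobenius_expand [RHS]quo_expand; apply: eq_bigr => l _.
  by rewrite exprM zd.
have K_gt1 : (1 < #|K|)%N by apply: finNzRing_gt1.
have Kd_gt1 : (1 < #|K| ^ d)%N by rewrite -(expn0 #|K|) ltn_exp2l.
pose P : {poly L} := 'X^(#|K| ^ d) - 'X.
have sP : size P = (#|K| ^ d).+1.
  by rewrite size_polyDl size_polyXn // size_polyN size_polyX ltnS.
have : (#|{: L}| < size P)%N.
  rewrite cardE; apply: max_poly_roots; last exact: enum_uniq.
    by rewrite -size_poly_eq0 sP.
  by apply/allP => a _; rewrite rootE !hornerE fixd subrr.
by rewrite sP ltnS card_quo leq_exp2l // leqNgt dn.
Qed.

(* The Vandermonde matrix of the conjugates of Z diagonalizes the
   multiplication by [a]. *)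
Lemma quo_trace_frobenius (a : L) :
  (quo_trace a)%:A = \sum_(i < n) a ^+ (#|K| ^ i) :> L.
Proof.
pose z : L := ('qX : {poly %/ monicize h}).
pose A : 'M[L]_n := \matrix_(i, j) in_alg L (a * z ^+ j : L)`_i.
pose W : 'M[L]_n := (Vandermonde n (\row_j z ^+ (#|K| ^ j)))^T.
pose D : 'M[L]_n := diag_mx (\row_j a ^+ (#|K| ^ j)).
have WE i j : W i j = z ^+ (#|K| ^ i * j) by rewrite !mxE exprM.
have unitW : W \in unitmx.
  rewrite unitmxE det_tr det_Vandermonde unitfE; apply/prodf_neq0 => i _.
  apply/prodf_neq0 => j ij; rewrite !mxE subr_eq0 eq_sym.
  by apply: frobenius_qX_inj; rewrite ij /=.
have eDW : D *m W = W *m A.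
  apply/matrixP => i j; rewrite mul_diag_mx !mxE.
  rewrite exprAC -exprMn frobenius_expand; apply: eq_bigr => l _.
  by rewrite WE mxE in_algE mulr_algr.
have trA : \tr A = in_alg L (quo_trace a).
  rewrite /quo_trace /mxtrace rmorph_sum.
  by apply: eq_bigr => i _; rewrite !mxE.
rewrite -in_algE -trA.
have -> : A = invmx W *m (D *m W) by rewrite eDW mulKmx.
by rewrite mxtrace_mulC -mulmxA mulmxV // mulmx1 mxtrace_diag;
  apply: eq_bigr => i _; rewrite mxE.
Qed.

End QuoTrace.

(** * Counting non-residues *)

Lemma card_finField_pow (K : finFieldType) :
  exists p n, [/\ prime p, p \in [pchar K] & #|K| = (p ^ n)%N].
Proof.
have /is_abelemP[p p_pr] := finField_is_abelem K.
move=> /abelem_pgroup/p_natP[n]; rewrite cardsT => nE.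
by exists p, n; rewrite (card_finPcharP nE).
Qed.

Section OddFiniteField.
Variable K : finFieldType.
Hypothesis two_neq0 : 2%:R != 0 :> K.

Lemma card_odd_finField : odd #|K|.
Proof.
have [p [n [p_pr pK nE] ] ] := card_finField_pow K.
have p_odd : odd p.
  have [p2|//] := even_prime p_pr.
  by move: pK two_neq0; rewrite p2 inE /= => /eqP ->; rewrite eqxx.
by rewrite nE oddX p_odd orbT.
Qed.

Lemma neg1_neq1 : -1 != 1 :> K.
Proof. by rewrite eq_sym -addr_eq0. Qed.

(** Euler's criterion: the unit group is cyclic of even order N, and g^i with (g^i)^(N/2) = 1 has i
    even. It turns the test into the vanishing of a computable value. *)
Lemma nonresidueE (a : K) : nonresidue a = (a ^+ (#|K|.-1)./2 == -1).
Proof.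
have N2 : ((#|K|.-1)./2 * 2 = #|K|.-1)%N.
  have := card_odd_finField; have := finNzRing_gt1 K; lia.
have N_gt0 : (0 < (#|K|.-1)./2)%N.
  by move: N2 card_odd_finField (finNzRing_gt1 K); move: #|K| => c; lia.
have expE (x : K) : x != 0 -> x ^+ (#|K|.-1) = 1.
  move=> x0; apply: (mulfI x0); rewrite mulr1 -exprS.
  by rewrite prednK ?expf_card // (ltn_trans _ (finNzRing_gt1 K)).
apply/idP/idP => [a_non|]; last first.
  move=> /eqP aE; apply/negP => /existsP[b /eqP bE].
  have [b0|b0] := eqVneq b 0.
    move: aE; rewrite -bE b0 expr0n /= expr0n; case: eqP => _.
      by apply/eqP; rewrite eq_sym neg1_neq1.
    by move/eqP; rewrite eq_sym oppr_eq0 oner_eq0.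
  move/eqP: aE; rewrite -bE -exprM mulnC N2 expE //.
  by rewrite eq_sym (negPf neg1_neq1).
have a0 : a != 0.
  by apply: contraNneq a_non => ->; apply/existsP; exists 0; rewrite expr0n.
have : (a ^+ (#|K|.-1)./2) ^+ 2 == 1 by rewrite -exprM N2 expE.
rewrite sqrf_eq1 => /orP[|//] /eqP a1; exfalso; move/negP: a_non; apply.
have /cyclicP[g gE] := field_unit_group_cyclic [set: {unit K}].
have ua : a \is a GRing.unit by rewrite unitfE.
have /cycleP[i iE] : FinRing.unit K ua \in <[g]>%g by rewrite -gE inE.
have aE : a = val g ^+ i by rewrite -FinRing.val_unitX -iE.
have og : #[g]%g = #|K|.-1 by rewrite -card_finField_unit gE.
have : (#[g]%g %| i * (#|K|.-1)./2)%N.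
  by rewrite order_dvdn; apply/eqP/val_inj; rewrite FinRing.val_unitX exprM -aE.
rewrite og -{1}N2 mulnC dvdn_pmul2r //.
move=> /dvdnP[j jE]; apply/existsP; exists (val g ^+ j).
by rewrite -exprM -jE -aE.
Qed.

(** If t^2 - 4 = b^2, the roots x and y = 1/x of X^2 - t X + 1 lie in K, and each of them determines
    t. The two injections land in the nonzero elements, and their images meet at most in 1 and -1,
    as x t = y t' forces t = t' and x^2 = 1. Hence twice the count is at most (#|K| - 1) + 2. *)
Lemma card_residue_sq_sub4 :
  (2 * #|[set t : K | ~~ nonresidue (t ^+ 2 - 4%:R)%R]%SET| <= #|K|.+1)%N.
Proof.
set Sq := [set t | _]%SET.
have sqP t : t \in Sq -> exists b, b ^+ 2 == t ^+ 2 - 4%:R.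
  by rewrite inE negbK => /existsP.
pose b t := if @idP (t \in Sq) is ReflectT H then xchoose (sqP t H) else 0.
have bE t : t \in Sq -> b t ^+ 2 = t ^+ 2 - 4%:R.
  by rewrite /b; case: {-}_ / idP => // H _; apply/eqP/(xchooseP (sqP t H)).
pose x t := (t + b t) / 2%:R; pose y t := (t - b t) / 2%:R.
have four_neq0 : 4%:R != 0 :> K by rewrite (natrM _ 2 2) mulf_neq0.
have xy t : t \in Sq -> x t * y t = 1.
  move=> /bE be.
  have -> : x t * y t = (t ^+ 2 - b t ^+ 2) / 4%:R.
    by rewrite /x /y; field; rewrite ?two_neq0 ?four_neq0.
  by rewrite be; field; rewrite ?two_neq0 ?four_neq0.
have xDy t : x t + y t = t by rewrite /x /y; field;
  rewrite ?two_neq0 ?four_neq0.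
have yV t : t \in Sq -> y t = (x t)^-1.
  move=> tS; have := xy t tS; have [-> /eqP|x0 e] := eqVneq (x t) 0.
    by rewrite mul0r eq_sym oner_eq0.
  by rewrite -[y t]mul1r -(mulVf x0) -mulrA e mulr1.
have tE t : t \in Sq -> t = x t + (x t)^-1 by move=> tS; rewrite -yV ?xDy.
have tE' t : t \in Sq -> t = y t + (y t)^-1.
  by move=> tS; rewrite yV // invrK addrC -tE.
have x_inj : {in Sq &, injective x} by move=> t t' tS tS' e;
  rewrite (tE t) // (tE t') // e.
have y_inj : {in Sq &, injective y} by move=> t t' tS tS' e;
  rewrite (tE' t) // (tE' t') // e.
have sU : x @: Sq :|: y @: Sq \subset [set~ 0%R]%SET.
  apply/fintype.subsetP => z; rewrite !inE => /orP[] /imsetP[t tS ->];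
    by apply/negP => /eqP e; have /eqP := xy t tS;
      rewrite e ?mul0r ?mulr0 eq_sym oner_eq0.
have sI : x @: Sq :&: y @: Sq \subset [set 1%R; (- 1)%R]%SET.
  apply/fintype.subsetP => z;
    rewrite !inE => /andP[/imsetP[t tS zt] /imsetP[t' tS' zt'] ].
  have tt' : t = t' by rewrite (tE t) // -zt zt' -tE'.
  rewrite -sqrf_eq1; apply/eqP; rewrite expr2 {1}zt zt' -tt'.
  exact: xy.
have := subset_leq_card sU; have := subset_leq_card sI.
have := cardsUI (x @: Sq) (y @: Sq); rewrite !card_in_imset //.
rewrite cardsC1 cards2 => e1 e2 e3.
have := finNzRing_gt1 K; move: e1 e2 e3.
move: #|Sq| #|_ :|: _| #|_ :&: _| #|K| => m1 m2 m3 m4.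
by case: (_ != _) => /=; lia.
Qed.

Lemma horner_bracket n (t : K) : (bracket n 'X).[t] = bracket n t.
Proof. by rewrite -horner_evalE (bracket_rmorph (horner_eval t)) /=
  horner_evalE hornerX. Qed.

Lemma size_bracketX n : size (bracket n.+1 ('X : {poly K})) = n.+2.
Proof.
elim/ltn_ind: n => -[|n] IH; first by rewrite size_polyX.
rewrite -[bracket n.+2 'X]/('X * bracket n.+1 'X - bracket n 'X).
have sX : size ('X * bracket n.+1 'X : {poly K}) = n.+3.
  rewrite mulrC size_mulX ?IH //.
  by rewrite -size_poly_eq0 IH.
rewrite size_polyDl // size_polyN sX.
case: n IH {sX} => [|n] IH; last by rewrite IH // ltnW.
by rewrite /= -polyC_natr size_polyC; case: (_ != _).
Qed.

Lemma bracket2 n : bracket n (2%:R : K) = 2%:R.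
Proof. by rewrite -[2%:R]/(1 + 1 : K) bracket_inv ?mulr1 // !expr1n. Qed.

(** The bound is strict because 2 is a further root of the polynomial [bracket n 'X - 2], of degree
    n: it is excluded from the set, as 2^2 - 4 = 0 is a square. *)
Lemma bracket_eq2_card n : (0 < n)%N ->
  (#|[set t : K | nonresidue (t ^+ 2 - 4%:R)%R &
    (bracket n t == 2%:R)%R]%SET| < n)%N.
Proof.
move=> n_gt0; set B := [set t | _ & _]%SET.
pose P : {poly K} := bracket n 'X - 2%:R%:P.
have sP : size P = n.+1.
  rewrite /P; case: n n_gt0 {B P} => // n _.
  rewrite size_polyDl size_bracketX // size_polyN size_polyC.
  by case: (_ != _).
have two_B : 2%:R \notin B.
  rewrite inE nonresidueE.
  have -> : 2%:R ^+ 2 - 4%:R = 0 :> K by ring.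
  have := finNzRing_gt1 K; have := card_odd_finField => o1 o2.
  have -> : 0 ^+ (#|K|.-1)./2 = 0 :> K.
    rewrite expr0n; case: eqP => // e.
    by move: e o1 o2; move: #|K| => c; lia.
  by rewrite eq_sym oppr_eq0 oner_eq0.
have : (size (2%:R :: enum B) < size P)%N.
  apply: max_poly_roots; first by rewrite -size_poly_eq0 sP.
    rewrite /= rootE !hornerE horner_bracket bracket2 subrr eqxx /=.
    apply/allP => t; rewrite mem_enum inE => /andP[_ /eqP tE].
    by rewrite rootE !hornerE horner_bracket tE subrr.
  by rewrite /= mem_enum two_B enum_uniq.
by rewrite sP /= -cardE.
Qed.

End OddFiniteField.

(** * Elements of norm one *)

(** Z is sent to a root in L of the image of the modulus. The morphism extends the prescribed [eps],
    so that different extensions of K can be compared inside the same L. *)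
Lemma quo_embedding (K : finFieldType) (h : {poly K})
    (hI : irreducible_poly h) (L : closedFieldType) (eps : {rmorphism K -> L}) :
  exists f : {rmorphism quo hI -> L}, forall c : K, f c%:A = eps c.
Proof.
pose m := mk_monic (monicize h).
have m_mon : m \is monic := monic_mk_monic _.
have /closed_rootP[y /rootP my] : size (map_poly eps m) != 1%N.
  by rewrite size_map_poly gtn_eqF // size_mk_monic_gt1.
pose ev (a : quo hI) := (map_poly eps (a : {poly K})).[y].
have evB : zmod_morphism ev.
  by move=> a b; rewrite /ev [polyn _]raddfB rmorphB /= hornerD hornerN.
have evM : monoid_morphism ev.
  split=> [|a b]; rewrite /ev; first by
    rewrite (_ : polyn (1 : quo hI) = 1%:P) // rmorph1 hornerC.
  rewrite -[RHS]hornerM -rmorphM.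
  rewrite [in RHS](Pdiv.RingMonic.rdivp_eq m_mon
    ((a : {poly K}) * (b : {poly K}))).
  by rewrite rmorphD rmorphM /= hornerD hornerM my mulr0 add0r.
pose evZ := GRing.isZmodMorphism.Build _ _ ev evB.
pose evR := GRing.isMonoidMorphism.Build _ _ ev evM.
pose f : {rmorphism quo hI -> L} := HB.pack ev evZ evR.
exists f => c; rewrite -[f _]/(ev _) /ev.
have -> : polyn (c%:A : quo hI) = c%:P.
  by rewrite -[polyn _]/(c *: 1) alg_polyC.
by rewrite map_polyC hornerC.
Qed.

Lemma closed_sum_inv (L : closedFieldType) (y : L) :
  exists2 w : L, w != 0 & y = w + w^-1.
Proof.
pose P : {poly L} := 'X^2 - (y *: 'X - 1).
have sP : size P = 3%N.
  rewrite /P size_polyDl size_polyXn // size_polyN ltnS.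
  rewrite (leq_trans (size_polyD _ _)) // geq_max size_polyN size_poly1 andbT.
  by rewrite (leq_trans (size_scale_leq _ _)) ?size_polyX.
have /closed_rootP[w] : size P != 1%N by rewrite sP.
rewrite rootE !hornerE => /eqP wP.
have {wP} wP : w * (y - w) = 1 by rewrite -[LHS](addr0) -wP; ring.
have w0 : w != 0 by apply: contra_eq_neq wP => ->;
  rewrite mul0r eq_sym oner_eq0.
exists w => //; have -> : w^-1 = y - w by apply: (mulfI w0); rewrite wP divff.
by rewrite addrC subrK.
Qed.

(** With y = w + 1/w in a closure, both sides are w^(p^m) + w^(-p^m). The brackets in the last step
    of the conic algorithm are therefore Frobenius conjugates. *)
Lemma bracket_pchar (K : finFieldType) (p m : nat) (y : K) :
  p \in [pchar K] -> bracket (p ^ m) y = y ^+ (p ^ m).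
Proof.
move=> pK; have [L [eps _] ] := countable_algebraic_closure K.
have pL : p \in [pchar L] by rewrite (fmorph_pchar eps).
have [w w0 yE] := closed_sum_inv (eps y).
apply: (fmorph_inj eps);
  rewrite bracket_rmorph rmorphXn yE bracket_inv ?divff //.
by rewrite (exprD_pchar_pow pL).
Qed.

Section NormOne.
Variables (K : finFieldType) (L : closedFieldType) (iota : {rmorphism K -> L}).

Lemma fixed_card_image (w : L) : w ^+ #|K| = w -> exists x, w = iota x.
Proof.
move=> wK; have : root (map_poly iota ('X^#|K| - 'X)) w.
  by rewrite rmorphB /= map_polyXn map_polyX rootE !hornerE wK subrr.
rewrite finField_genPoly rmorph_prod rootE horner_prod /= => /prodf_eq0.
by case=> x _; rewrite map_polyXsubC !hornerE subr_eq0 => /eqP ->; exists x.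
Qed.

(** With Q = #|K|, w^Q is a root of the same quadratic X^2 - t X + 1 as w, hence w or 1/w. The first
    case would put w in K and make t^2 - 4 the square of w - 1/w. *)
Lemma nonresidue_norm_one (t : K) : nonresidue (t ^+ 2 - 4%:R) ->
  exists w : L, [/\ w != 0, iota t = w + w^-1 & w ^+ #|K|.+1 = 1].
Proof.
move=> t_non; have [p [n [p_pr pK cardK] ] ] := card_finField_pow K.
have pL : p \in [pchar L] by rewrite (fmorph_pchar iota).
have [w w0 tE] := closed_sum_inv (iota t).
exists w; split=> //.
have tK : w ^+ #|K| + (w ^+ #|K|)^-1 = w + w^-1.
  rewrite -exprVn -tE cardK -(exprD_pchar_pow pL) -tE -cardK.
  by rewrite -rmorphXn expf_card.
have wK0 : w ^+ #|K| != 0 by rewrite expf_neq0.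
have : (w ^+ #|K| - w) * (w ^+ #|K|.+1 - 1) = 0.
  rewrite exprS; set v := w ^+ #|K| in tK wK0 *.
  have -> : (v - w) * (w * v - 1) = v * w * (v + v^-1 - (w + w^-1)).
    by field; rewrite w0 wK0.
  by rewrite tK subrr mulr0.
move/eqP; rewrite mulf_eq0 !subr_eq0 => /orP[/eqP wK|/eqP //].
have [x xE] := fixed_card_image wK; move/negP: t_non; case.
have x0 : x != 0 by rewrite -(fmorph_eq0 iota) -xE.
have tx : t = x + x^-1.
  by apply: (fmorph_inj iota); rewrite tE xE rmorphD fmorphV.
by apply/existsP; exists (x - x^-1); rewrite tx; apply/eqP; field.
Qed.

End NormOne.

(** * Arithmetic modulo l *)

Section Params.
Variable P : params.
Local Notation q := (q P).
Local Notation r := (r P).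
Local Notation l := (l P).
Local Notation s := (s P).

Lemma rs_gt0 : (0 < r)%N /\ (0 < s)%N.
Proof.
have := order_gt0 (qmod P); rewrite order_qmod.
by case: (Defs.r P) (Defs.s P) => [|a] [|b] //; rewrite muln0.
Qed.

Lemma l_gt1 : (1 < l)%N. Proof. exact: prime_gt1 (l_prime P). Qed.

Lemma card_units_l : #|units_Zp l| = l.-1.
Proof. by rewrite card_units_Zp ?totient_prime ?prime_gt0 ?(l_prime P). Qed.

Lemma card_Sgrp : (2 * r * s * #|Sgrp P| = l.-1)%N.
Proof. by rewrite -card_units_l -(dprod_card (unitsE P)) -orderE order_qmod.
  Qed.

Lemma q_natr_unit (n : nat) :
  (FinRing.uval (qmod P ^+ n)%g : 'Z_l) = (q ^ n)%:R.
Proof. by rewrite FinRing.val_unitX [_ (qmod P)](qmodE P) natrX. Qed.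

Lemma Zl_natr_eq0 (n : nat) : (n%:R == 0 :> 'Z_l) = (l %| n)%N.
Proof.
rewrite -(inj_eq val_inj) /= val_Zp_nat ?l_gt1 //.
Qed.

Lemma l_dvd_conic : (l %| q ^ (r * s) + 1)%N.
Proof.
have [r_gt0 s_gt0] := rs_gt0.
have q_gt0 : (0 < q)%N := prime_gt0 (q_prime P).
have q2 : (l %| (q ^ (r * s) - 1) * (q ^ (r * s) + 1))%N.
  have -> : ((q ^ (r * s) - 1) * (q ^ (r * s) + 1) = q ^ (2 * r * s) - 1)%N.
    have -> : (q ^ (2 * r * s) = (q ^ (r * s)) ^ 2)%N.
      by rewrite -expnM; congr expn; ring.
    by rewrite -[in RHS](exp1n 2) subn_sqr.
  rewrite -Zl_natr_eq0 natrB ?expn_gt0 ?q_gt0 // subr_eq0 -q_natr_unit.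
  by rewrite -order_qmod expg_order.
move: q2; rewrite Euclid_dvdM ?l_prime // => /orP[|//].
rewrite -Zl_natr_eq0 natrB ?expn_gt0 ?q_gt0 // subr_eq0 -q_natr_unit => e.
have /eqP : (qmod P ^+ (r * s))%g = 1%g by apply: val_inj; apply/eqP.
rewrite -order_dvdn order_qmod -mulnA => /dvdn_leq.
by rewrite muln_gt0 r_gt0 s_gt0 => /(_ isT); nia.
Qed.

Lemma l_gt2 : (2 < l)%N.
Proof.
have := card_Sgrp; have [r_gt0 s_gt0] := rs_gt0.
have := cardG_gt0 (Sgrp P); have := l_gt1; nia.
Qed.

Lemma qmod_decomp (t : nat) : coprime l t ->
  exists j (sigma : {unit 'Z_l}), sigma \in Sgrp P /\
    (t%:R : 'Z_l) = (q ^ j)%:R * FinRing.uval sigma.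
Proof.
move=> cop; have ut : (t%:R : 'Z_l) \is a GRing.unit.
  by rewrite unitZpE ?l_gt1.
have : FinRing.unit _ ut \in units_Zp l by rewrite inE.
case/(mem_dprod (unitsE P)) => a [b [ha hb e _] ].
have /cycleP[j jE] := ha; exists j, b; split=> //.
have := congr1 (FinRing.uval : {unit 'Z_l} -> 'Z_l) e => /= ->.
by rewrite jE -q_natr_unit.
Qed.

End Params.

(** * The Galois orbit *)

Section GaussPeriod.
Variables (P : params) (L : comNzRingType).
Local Notation l := (l P).
Local Notation q := (q P).

Definition gauss_period (w : L) : L :=
  \sum_(sigma in Sgrp P) w ^+ (FinRing.uval sigma : 'Z_l).

Lemma expr_Zl (w : L) (n m : nat) :
  w ^+ l = 1 -> (n%:R : 'Z_l) = m%:R -> w ^+ n = w ^+ m.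
Proof.
move=> wl /(congr1 val) /=; rewrite !val_Zp_nat ?l_gt1 // => e.
by rewrite -(expr_mod n wl) e expr_mod.
Qed.

Hypothesis qL : q \in [pchar L].

Lemma gauss_period_frobenius (w : L) (j : nat) :
  gauss_period w ^+ (q ^ j) = gauss_period (w ^+ (q ^ j)).
Proof.
rewrite /gauss_period (expr_sum_pchar_pow qL); apply: eq_bigr => sigma _.
by rewrite exprAC.
Qed.

Lemma gauss_period_conj (w : L) (t : nat) : w ^+ l = 1 -> coprime l t ->
  exists j, gauss_period (w ^+ t) = gauss_period w ^+ (q ^ j).
Proof.
move=> wl /qmod_decomp[j [sigma [sS tE] ] ]; exists j.
rewrite gauss_period_frobenius /gauss_period [RHS](reindex_inj (mulgI sigma)).
apply: eq_big => [tau|tau _]; first by rewrite groupMl.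
rewrite -!exprM; apply: expr_Zl => //.
by rewrite !natrM tE !natr_Zp -mulrA.
Qed.

End GaussPeriod.

Section Orbit.
Variables (P : params) (D : input P).
Local Notation q := (q P).
Local Notation r := (r P).
Local Notation l := (l P).
Local Notation s := (s P).
Local Notation K := (finvect_type (k D)).
Local Notation k' := (quo (h_irr D)).

Lemma card_k : #|{: K}| = (q ^ r)%N.
Proof.
have := @card_vspace 'F_q K (Vector.class K) {: k D}%VS.
rewrite k_degree card_Fp ?(q_prime P) // => <-.
by apply: eq_card => a; rewrite [RHS]memvf.
Qed.

Lemma pchar_k : q \in [pchar K].
Proof. exact: card_finPcharP card_k (q_prime P). Qed.

Lemma pchar_k' : q \in [pchar k'].
Proof. exact: (pchar_quo (q_prime P) card_k). Qed.

Lemma two_neq0_k' : 2%:R != 0 :> k'.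
Proof.
apply/negP => e; have : 2 \in [pchar k'] by rewrite inE /=.
by rewrite (pcharf_eq pchar_k') inE => /eqP e2; have := q_odd P; rewrite -e2.
Qed.

Lemma card_k' : #|{: k'}| = (q ^ (r * s))%N.
Proof. by rewrite (card_quo (h_irr D)) card_k -expnM h_size. Qed.

Lemma conic_order : ((#|{: k'}| + 1) %/ l * l = #|{: k'}| + 1)%N.
Proof. by rewrite divnK // card_k' l_dvd_conic. Qed.

(** As l is prime, an l-th root of unity has order 1 or l; order 1 would give zeta = 1 + 1, which
    the outer loop rejects. *)
Lemma zeta_root (L : closedFieldType) (iota : {rmorphism k' -> L}) (t : k') :
  nonresidue (t ^+ 2 - 4%:R) -> zeta_of t != 2%:R ->
  exists w : L, [/\ l.-primitive_root w & iota (zeta_of t) = w + w^-1].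
Proof.
move=> t_non z2.
have [w [w0 tE wK] ] := nonresidue_norm_one iota t_non.
pose n := ((#|{: k'}| + 1) %/ l)%N.
have zE : iota (zeta_of t) = w ^+ n + (w ^+ n)^-1.
  by rewrite /zeta_of bracket_rmorph tE bracket_inv ?divff // exprVn.
have wl : (w ^+ n) ^+ l = 1 by rewrite -exprM conic_order addn1.
exists (w ^+ n); split=> //.
have [m prim_m ml] := prim_order_exists (prime_gt0 (l_prime P)) wl.
have /primeP[_ /(_ _ ml)/orP[/eqP m1|/eqP <-] ] := l_prime P; last by [].
move: prim_m; rewrite m1 => /prim_expr_order; rewrite expr1 => w1.
move/eqP: z2; case; apply: (fmorph_inj iota).
by rewrite zE w1 invr1 rmorph_nat.
Qed.

Lemma eta_gauss_period (L : closedFieldType) (iota : {rmorphism k' -> L})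
    (z : k') (w : L) : w != 0 -> iota z = w + w^-1 ->
  iota (eta z) = gauss_period P w + gauss_period P w^-1.
Proof.
move=> w0 zE; rewrite /eta rmorph_sum -big_split; apply: eq_bigr => sigma _ /=.
by rewrite bracket_rmorph zE bracket_inv ?divff.
Qed.

Lemma conic_outcome (cost : task -> nat) (alpha : K) :
  outcome (rains_conic D cost) alpha ->
  exists t : k', [/\ nonresidue (t ^+ 2 - 4%:R), zeta_of t != 2%:R &
    alpha = quo_trace (eta (zeta_of t))].
Proof.
move=> [_ _ [z [zO z2] [_ _ [_ _ ->] ] ] ].
move: zO => [t [ [t0 _ [_ _ tE] ] t_non] [_ _ [_ _ zE] ] ].
by exists t; rewrite zE in z2 *.
Qed.

Lemma conic_gauss_period (cost : task -> nat) (L : closedFieldType)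
    (eps : {rmorphism K -> L}) (alpha : K) :
  outcome (rains_conic D cost) alpha ->
  exists2 w : L, l.-primitive_root w & eps alpha =
    \sum_(i < 2 * s) gauss_period P w ^+ ((q ^ r) ^ i).
Proof.
move=> /conic_outcome[t [t_non z2 ->] ].
have [iota iotaE] := quo_embedding (h_irr D) eps.
have [w [w_prim zE] ] := zeta_root iota t_non z2.
have wl := prim_expr_order w_prim.
have w0 : w != 0.
  apply: contra_eq_neq wl => ->.
  by rewrite expr0n gtn_eqF ?prime_gt0 ?(l_prime P) // eq_sym oner_eq0.
have qL : q \in [pchar L] by rewrite (fmorph_pchar eps) pchar_k.
exists w => //; rewrite -iotaE (quo_trace_frobenius (q_prime P) card_k).
rewrite rmorph_sum card_k h_size /=.
have wV : w^-1 = w ^+ (q ^ (r * s)).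
  apply: (mulfI w0); rewrite divff // -exprS -addn1.
  have /dvdnP[c ->] := l_dvd_conic P.
  by rewrite mulnC exprM wl expr1n.
have frobS i : ((q ^ r) ^ i = q ^ (r * i))%N by rewrite expnM.
have etaE : iota (eta (zeta_of t))
    = gauss_period P w + gauss_period P w ^+ ((q ^ r) ^ s).
  by rewrite (eta_gauss_period w0 zE) wV frobS gauss_period_frobenius.
rewrite mul2n -addnn big_split_ord /= -big_split; apply: eq_bigr => i _.
rewrite rmorphXn /= frobS etaE (exprD_pchar_pow qL) -frobS -exprM -expnD.
by [].
Qed.

Lemma cyclotomic_gauss_period (g : {poly K}) (g_irr : irreducible_poly g)
    (L : closedFieldType) (eps : {rmorphism K -> L}) (beta : K) :
  size g = (2 * s).+1 -> outcome (rains_cyclotomic g_irr) beta ->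
  exists2 w : L, l.-primitive_root w & eps beta =
    \sum_(i < 2 * s) gauss_period P w ^+ ((q ^ r) ^ i).
Proof.
move=> g_size [z [_ z_prim] ->].
have [iota iotaE] := @quo_embedding K g g_irr L eps.
exists (iota z); first by rewrite fmorph_primitive_root.
rewrite -iotaE (quo_trace_frobenius (q_prime P) card_k).
rewrite rmorph_sum card_k g_size /=; apply: eq_bigr => i _.
rewrite rmorphXn rmorph_sum; congr (_ ^+ _); apply: eq_bigr => sigma _.
by rewrite rmorphXn.
Qed.

Lemma frobenius_same_orbit (a : K) (j : nat) : same_galois_orbit a (a ^+ (q ^
  j)).
Proof.
have qk : q \in [pchar k D] := pchar_k.
pose frob (x : k D) : k D := x ^+ (q ^ j).
have frob_lin : linear frob.
  move=> c x y; rewrite /frob (exprD_pchar_pow qk); congr (_ + _).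
  rewrite exprZn; congr (_ *: _).
  elim: (j) => [|m IH]; first by rewrite expr1.
  rewrite expnSr exprM IH -[in X in _ ^+ X](card_Fp (q_prime P)).
  exact: expf_card.
pose fL := GRing.isLinear.Build _ _ _ _ frob frob_lin.
pose f : {linear k D -> k D} := HB.pack frob fL.
exists (linfun f); last by rewrite lfunE.
rewrite kAutfE; apply/kHom_monoid_morphism; split=> [|x y].
  by rewrite lfunE /= /frob expr1n.
by rewrite !lfunE /= /frob exprMn.
Qed.

Lemma conic_cyclotomic_orbit (cost : task -> nat) (g : {poly K})
    (g_irr : irreducible_poly g) (alpha beta : K) : size g = (2 * s).+1 ->
  outcome (rains_conic D cost) alpha -> outcome (rains_cyclotomic g_irr) beta ->
  same_galois_orbit alpha beta.
Proof.
move=> g_size aO bO.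
have [L [eps _] ] := countable_algebraic_closure K.
have [w w_prim aE] := conic_gauss_period eps aO.
have [w' w'_prim bE] := cyclotomic_gauss_period eps g_size bO.
have qL : q \in [pchar L] by rewrite (fmorph_pchar eps) pchar_k.
have [t w'E] := prim_rootP w_prim (prim_expr_order w'_prim).
have cop : coprime l t.
  by move: w'_prim; rewrite w'E prim_root_exp_coprime // coprime_sym.
have [j jE] := gauss_period_conj qL (prim_expr_order w_prim) cop.
suff -> : beta = alpha ^+ (q ^ j) by apply: frobenius_same_orbit.
apply: (fmorph_inj eps); rewrite rmorphXn aE bE (expr_sum_pchar_pow qL) w'E jE.
by apply: eq_bigr => i _; rewrite exprAC.
Qed.

End Orbit.

(** * Expected cost of the loops *)

Section Mean.
Variable R : realType.
Implicit Types (kappa x : R).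

(** The value is the fixed point of x -> a + b x. It bounds the iterates by induction. Conversely, u
    (n+1) <= sup gives u n <= (sup - a) / b for all n, so sup <= (sup - a) / b; this needs b
    nonzero, whence the separate case b = 0. *)
Lemma ereal_sup_affine (u : nat -> R) (a b : R) :
  0 <= a -> 0 <= b < 1 -> u 0 = 0 -> (forall n, u n.+1 = a + b * u n) ->
  ereal_sup (range (fun n => (u n)%:E)) = (a / (1 - b))%:E.
Proof.
move=> a0 /andP[b0 b1] u0 uS.
have b1' : 0 < 1 - b by rewrite subr_gt0.
have vE : a + b * (a / (1 - b)) = a / (1 - b) by field; rewrite gt_eqF.
apply/eqP; rewrite eq_le; apply/andP; split.
  apply: ge_ereal_sup => _ [n _ <-]; rewrite lee_fin.
  elim: n => [|n IH]; first by rewrite u0 divr_ge0 // ltW.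
  by rewrite uS -vE lerD2l ler_wpM2l.
have uSup n : ((u n)%:E <= ereal_sup (range (fun n => (u n)%:E)))%E.
  by apply: ereal_sup_ubound; exists n.
have supP (m : R) : (forall n, u n <= m) ->
    (ereal_sup (range (fun n => (u n)%:E)) <= m%:E)%E.
  by move=> um; apply: ge_ereal_sup => _ [n _ <-]; rewrite lee_fin.
move: uSup supP; case: (ereal_sup _) => [sup| |] uSup supP.
- rewrite lee_fin ler_pdivrMr // mulrBr mulr1 lerBrDr.
  have [b_eq0|b_neq0] := eqVneq b 0.
    by have := uSup 1%N; rewrite lee_fin uS u0 b_eq0 !mulr0 !addr0.
  have b_gt0 : 0 < b by rewrite lt_def b_neq0.
  have : sup <= (sup - a) / b.
    rewrite -lee_fin; apply: supP => n;
      rewrite ler_pdivlMr // lerBrDr addrC mulrC -uS.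
    by have := uSup n.+1; rewrite lee_fin.
  by rewrite ler_pdivlMr // lerBrDr addrC.
- by rewrite leey.
- by have := uSup 0%N; rewrite leeNy_eq.
Qed.

(** Here a collects the cost of one turn and the value upon success, and b is the probability of
    another turn: a geometric series. The premise is restricted to nonnegative x so that it can
    itself be proved for a body containing a loop. *)
Lemma mean_until_affine kappa (A : Type) (c : Defs.comp A) (t : pred A) (f : A
  -> R)
    (a b : R) :
  0 <= a -> 0 <= b < 1 ->
  (forall x, 0 <= x ->
     mean kappa c (fun v => if t v then (f v)%:E else x%:E) = (a + b * x)%:E) ->
  mean kappa (Until c t) (fun v => (f v)%:E) = (a / (1 - b))%:E.
Proof.
move=> a0 b01 cE; pose u n : R := iter n (fun x => a + b * x) 0.
rewrite -(ereal_sup_affine a0 b01 (u := u)) //=; congr ereal_sup.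
have u0 n : 0 <= u n.
  elim: n => [//|n IH]; rewrite /u iterS addr_ge0 // mulr_ge0 //.
  by case/andP: b01.
apply: eq_imagel => n _; elim: n => [//|n IH]; rewrite iterS -[RHS]cE // -{}IH.
by congr mean; apply/funext => v.
Qed.

Lemma mean_unif kappa (T : finType) (f : T -> R) :
  mean kappa (Unif T) (fun t => (f t)%:E) = ((\sum_t f t) / #|T|%:R)%:E.
Proof. by rewrite /= sumEFin -EFinM mulrC. Qed.

Lemma sum_if_const (T : finType) (p : pred T) (f : T -> R) (x : R) :
  \sum_t (if p t then f t else x)
  = \sum_(t | p t) f t + (#|T|%:R - #|p|%:R) * x.
Proof.
rewrite (bigID p) /=; congr (_ + _); first by apply: eq_bigr => t ->.
rewrite (eq_bigr (fun=> x)) => [|t /negPf -> //].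
rewrite sumr_const -(mulr_natl x); congr (_ * _).
by rewrite -(cardC p) natrD addrC addKr.
Qed.

Section ConicMean.
Variables (P : params) (D : input P) (cost : task -> nat).
Local Notation k' := (quo (h_irr D)).
Local Notation Q := #|{: k'}|.

Definition good_theta : pred k' := [pred t | nonresidue (t ^+ 2 - 4%:R)].
Definition good_zeta : pred k' := [pred t in good_theta | zeta_of t != 2%:R].

Lemma card_good_zeta : (Q <= 6 * #|good_zeta|)%N.
Proof.
(* Origin of the six: at least (Q - 1)/2 draws pass the residuosity test, at most (Q + 1)/3 - 1 of
   them give zeta = 2 since l >= 3, and the difference is (Q + 1)/6. *)
have arith (m c n z N G a : nat) : (2 * c <= m.+1)%N -> (z < n)%N ->
    (N + c = m)%N -> (G + z = N)%N -> (n * a = m + 1)%N -> (2 < a)%N ->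
    (m <= 6 * G)%N by nia.
have two := two_neq0_k' D.
pose n := ((Q + 1) %/ l P)%N.
have nl : (n * l P = Q + 1)%N by apply: conic_order.
have n_gt0 : (0 < n)%N by case: (n) nl => //; rewrite mul0n addn1.
pose z2 : pred k' := [pred t | zeta_of t != 2%:R].
have b1 : (2 * #|[predC good_theta]| <= Q.+1)%N.
  have := card_residue_sq_sub4 two; rewrite cardsE.
  by rewrite (eq_card (B := [predC good_theta])).
have b2 : (#|[predD good_theta & z2]| < n)%N.
  have := bracket_eq2_card two n_gt0; rewrite cardsE.
  rewrite (eq_card (B := [predD good_theta & z2])) // => t.
  by rewrite !inE negbK andbC.
have cN : (#|good_theta| + #|[predC good_theta]| = Q)%N := cardC good_theta.
have cG : (#|good_zeta| + #|[predD good_theta & z2]| = #|good_theta|)%N.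
  by rewrite -(cardID z2 good_theta); congr addn; apply: eq_card.
exact: (arith _ _ _ _ _ _ _ b1 b2 cN cG nl (l_gt2 P)).
Qed.

(** General in [kappa] and [v] in order to serve twice: [kappa = 1], [v = 0] is the expected cost,
    and [kappa = 0], [v = 1] the probability of termination. *)
Lemma mean_rains_conic kappa (v : R) :
  let N := #|good_theta|%:R : R in let G := #|good_zeta|%:R in
  0 <= kappa -> 0 <= v ->
  mean kappa (rains_conic D cost) (fun=> v%:E) =
  (kappa * ((cost Construct)%:R
     + (Q%:R * (cost Residuosity)%:R
        + N * ((cost Zeta)%:R + (cost NotTwo)%:R)) / G
     + (cost Eta)%:R + (cost Trace)%:R) + v)%:E.
Proof.
move=> N G kappa0 v0.
have Q_gt0 : 0 < Q%:R :> R by rewrite ltr0n (ltn_trans _ (finNzRing_gt1 k')).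
have G_gt0 : 0 < G by rewrite ltr0n; have := card_good_zeta;
  rewrite ltr0n in Q_gt0; lia.
have GN : G <= N.
  rewrite ler_nat; apply: subset_leq_card; apply/fintype.subsetP => t.
  by rewrite !inE => /andP[].
have NQ : N <= Q%:R by rewrite ler_nat max_card.
have N_gt0 : 0 < N := lt_le_trans G_gt0 GN.
pose w : R := kappa * (cost Eta)%:R + (kappa * (cost Trace)%:R + v).
pose inner := Until
         (theta <-- Unif k';
                _ <-- Tick (cost Residuosity);
                Ret theta)
           (fun theta => nonresidue (theta ^+ 2 - 4%:R)).
have innerE (f : k' -> R) : (forall t, 0 <= f t) ->
    mean kappa inner (fun t => (f t)%:E)
    = ((Q%:R * kappa * (cost Residuosity)%:R + \sum_(t | good_theta t) f t) /
      N)%:E.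
  (* A turn costs one residuosity test and is rejected with probability [1 - N / Q]. *)
  move=> f0; rewrite (@mean_until_affine _ _ _ _ _
    (kappa * (cost Residuosity)%:R + (\sum_(t | good_theta t) f t) / Q%:R)
    (1 - N / Q%:R)).
  - by congr EFin; field; rewrite !gt_eqF.
  - by rewrite addr_ge0 ?mulr_ge0 ?invr_ge0 ?sumr_ge0 // ltW.
  - rewrite subr_ge0 ler_pdivrMr // mul1r NQ /= ltrBlDr ltrDl.
    by rewrite divr_gt0.
  move=> x _.
  rewrite -[LHS]/(mean kappa (Unif k') (fun t =>
    ((kappa * (cost Residuosity)%:R)%:E
     + (if good_theta t then (f t)%:E else x%:E))%E)).
  rewrite (_ : (fun t => _) = (fun t : k' => (kappa * (cost Residuosity)%:R
    + (if good_theta t then f t else x))%:E)); last first.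
    by apply/funext => t; case: ifP; rewrite EFinD.
  rewrite mean_unif big_split /= sumr_const sum_if_const -mulr_natl.
  by congr EFin; field; rewrite gt_eqF.
rewrite -[LHS]/((kappa * (cost Construct)%:R)%:E + mean kappa
  (Until (theta <-- inner; _ <-- Tick (cost Zeta); _ <-- Tick (cost NotTwo);
          Ret (zeta_of theta)) (fun zeta => zeta != 2%:R))
  (fun z => (kappa * (cost Eta)%:R)%:E + ((kappa * (cost Trace)%:R)%:E +
    v%:E)))%E.
rewrite (_ : (fun z => _) = (fun z : k' => w%:E)); last first.
  by apply/funext => z; rewrite -!EFinD.
have w_ge0 : 0 <= w by rewrite !addr_ge0 ?mulr_ge0.
(* A theta leaving the inner loop is uniform among the N accepted ones, so a turn of the outer loop
   fails with probability [1 - G / N]. *)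
rewrite (@mean_until_affine _ _ _ _ _
  ((Q%:R * kappa * (cost Residuosity)%:R
    + N * kappa * ((cost Zeta)%:R + (cost NotTwo)%:R) + G * w) / N)
  (1 - G / N)).
- rewrite -EFinD; congr EFin; rewrite /w; field; rewrite !gt_eqF //.
- by rewrite divr_ge0 ?addr_ge0 ?mulr_ge0 // ltW.
- rewrite subr_ge0 ler_pdivrMr // mul1r GN /= ltrBlDr ltrDl.
  by rewrite divr_gt0.
move=> x x0.
rewrite -[LHS]/(mean kappa inner (fun t =>
    ((kappa * (cost Zeta)%:R)%:E + ((kappa * (cost NotTwo)%:R)%:E
     + (if zeta_of t != 2%:R then w%:E else x%:E)))%E)).
rewrite (_ : (fun t => _) = (fun t : k' => (kappa * (cost Zeta)%:R
  + (kappa * (cost NotTwo)%:R + (if zeta_of t != 2%:R then w else x)))%:E));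
  last first.
  by apply/funext => t; case: ifP; rewrite !EFinD.
rewrite innerE => [|t]; last by case: ifP; rewrite !addr_ge0 ?mulr_ge0.
have sumE : \sum_(t | good_theta t) (if zeta_of t != 2%:R then w else x)
    = G * w + (N - G) * x.
  rewrite (bigID (fun t => zeta_of t != 2%:R)) /=.
  rewrite (eq_bigr (fun=> w)) => [|t /andP[_ ->] //].
  rewrite [X in _ + X](eq_bigr (fun=> x)) => [|t /andP[_ /negPf -> //] ].
  rewrite !sumr_const -(mulr_natl w) -(mulr_natl x).
  have NE : N = G + #|[predD good_theta & [pred t | zeta_of t != 2%:R] ]|%:R.
    rewrite /N -(cardID [pred t | zeta_of t != 2%:R] good_theta) natrD.
    by congr (_%:R + _); apply: eq_card.
  rewrite NE addrAC subrr add0r; congr (_%:R * w + _%:R * x);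
    apply: eq_card => t //.
  by rewrite !inE andbC.
rewrite !big_split /= sumE !sumr_const -/N -!(mulr_natl (_ * _)).
by congr EFin; field; rewrite gt_eqF.
Qed.

Lemma termination_rains_conic : termination_prob R (rains_conic D cost) = 1%E.
Proof. by rewrite /termination_prob mean_rains_conic // mul0r add0r. Qed.

Lemma expected_cost_rains_conic :
  (expected_cost R (rains_conic D cost) <=
   (6 * ((cost Construct)%:R + (cost Residuosity)%:R + (cost Zeta)%:R
     + (cost NotTwo)%:R + (cost Eta)%:R + (cost Trace)%:R))%:E)%E.
Proof.
rewrite /expected_cost mean_rains_conic // lee_fin mul1r addr0.
have G6 : #|{: k'}|%:R <= 6 * #|good_zeta|%:R :> R.
  by rewrite -natrM ler_nat card_good_zeta.
have Q_gt0 : 0 < #|{: k'}|%:R :> R.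
  by rewrite ltr0n (ltn_trans _ (finNzRing_gt1 k')).
have G_gt0 : 0 < #|good_zeta|%:R :> R.
  by move: G6 Q_gt0; lra.
have NQ : #|good_theta|%:R <= #|{: k'}|%:R :> R by rewrite ler_nat max_card.
have N6 := le_trans NQ G6.
have frac_le : (#|{: k'}|%:R * (cost Residuosity)%:R
    + #|good_theta|%:R * ((cost Zeta)%:R + (cost NotTwo)%:R)) / #|good_zeta|%:R
    <= 6 * ((cost Residuosity)%:R + ((cost Zeta)%:R + (cost NotTwo)%:R)) :> R.
  rewrite ler_pdivrMr // mulrAC [leRHS]mulrDr.
  by apply: lerD; apply: ler_wpM2r => //; rewrite addr_ge0.
have c0 : 0 <= (cost Construct)%:R :> R by [].
have c4 : 0 <= (cost Eta)%:R :> R by [].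
have c5 : 0 <= (cost Trace)%:R :> R by [].
by move: frac_le c0 c4 c5; move: (_ / _) => y; lra.
Qed.
End ConicMean.

End Mean.

(** * Arithmetic of k and of k' *)

Section PowerBasis.
Variables (F : fieldType) (L : fieldExtType F) (x : L) (r : nat).
Hypotheses (dimL : \dim {:L} = r) (x_gen : <<1; x>>%VS = fullv).

Definition power_basis : r.-tuple L := [tuple x ^+ i | i < r].

Lemma power_basis_nth (i : 'I_r) : power_basis`_i = x ^+ i.
Proof. by rewrite -tnth_nth tnth_mktuple. Qed.

Lemma adjoin_degree_gen : adjoin_degree 1 x = r.
Proof. by rewrite -dimL -x_gen dim_Fadjoin dimv1 muln1. Qed.

Lemma power_basisP : basis_of fullv power_basis.
Proof.
rewrite basisEdim size_tuple dimL leqnn andbT.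
apply/subvP => v _; have v_gen : v \in <<1; x>>%VS by rewrite x_gen memvf.
rewrite -(Fadjoin_poly_eq v_gen); have := size_Fadjoin_poly 1 x v.
rewrite adjoin_degree_gen; have /polyOver1P[p ->] := Fadjoin_polyOver 1 x v.
move=> sp; rewrite (horner_coef_wide _ sp); apply: memv_suml => i _.
rewrite coef_map /= mulr_algl; apply: memvZ.
by rewrite -(power_basis_nth i) memv_span // mem_nth // size_tuple.
Qed.

Definition power_poly (a : L) : {poly F} :=
  Poly [seq coord power_basis i a | i <- enum 'I_r].

Lemma coef_power_poly a (i : 'I_r) : (power_poly a)`_i = coord power_basis i a.
Proof.
by rewrite coef_Poly (nth_map i) ?size_enum_ord // nth_ord_enum.
Qed.

Lemma size_power_poly a : (size (power_poly a) <= r)%N.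
Proof. by apply: leq_trans (size_Poly _) _; rewrite size_map size_enum_ord. Qed.

Lemma horner_alg_sum (p : {poly F}) : (size p <= r)%N ->
  horner_alg x p = \sum_(i < r) p`_i *: power_basis`_i.
Proof.
move=> sp; rewrite /horner_alg /= /horner_morph.
rewrite (@horner_coef_wide _ r) => [|]; last first.
  by rewrite size_map_poly.
by apply: eq_bigr => i _; rewrite coef_map /= mulr_algl power_basis_nth.
Qed.

Lemma horner_power_poly a : horner_alg x (power_poly a) = a.
Proof.
rewrite horner_alg_sum ?size_power_poly //.
rewrite [RHS](coord_basis power_basisP) ?memvf //.
by apply: eq_bigr => i _; rewrite coef_power_poly.
Qed.

Lemma power_poly_horner (p : {poly F}) :
  (size p <= r)%N -> power_poly (horner_alg x p) = p.
Proof.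
move=> sp; apply/polyP => i; have [ir|ri] := ltnP i r; last first.
  by rewrite !nth_default // ?(leq_trans sp) // (leq_trans (size_power_poly _)).
rewrite (coef_power_poly _ (Ordinal ir)) horner_alg_sum //.
by rewrite coord_sum_free // (basis_free power_basisP).
Qed.

Lemma power_polyD a b : power_poly (a + b) = power_poly a + power_poly b.
Proof.
rewrite -{1}(horner_power_poly a) -{1}(horner_power_poly b) -rmorphD.
rewrite power_poly_horner // (leq_trans (size_polyD _ _)) //.
by rewrite geq_max !size_power_poly.
Qed.

Lemma power_poly0 : power_poly 0 = 0.
Proof. by rewrite -(rmorph0 (horner_alg x)) power_poly_horner // size_poly0.
  Qed.

Lemma power_polyB a b : power_poly (a - b) = power_poly a - power_poly b.
Proof. by apply: (canRL (addrK _)); rewrite -power_polyD subrK. Qed.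

Lemma power_dim_gt0 : (0 < r)%N.
Proof. by rewrite -dimL adim_gt0. Qed.

Lemma power_poly1 : power_poly 1 = 1.
Proof.
by rewrite -(rmorph1 (horner_alg x)) power_poly_horner // size_poly1
  power_dim_gt0.
Qed.

Lemma power_polyM a b : power_poly (a * b)
  = (power_poly a * power_poly b) %% ('X^r - power_poly (x ^+ r)).
Proof.
set f := 'X^r - _; have s_phi := size_power_poly (x ^+ r).
have f0 : horner_alg x f = 0.
  by rewrite rmorphB /= horner_power_poly rmorphXn /= horner_algX subrr.
rewrite -[RHS]power_poly_horner ?size_mod_modulus //; congr power_poly.
rewrite -{1}(horner_power_poly a) -{1}(horner_power_poly b) -rmorphM.
by rewrite {1}(divp_eq (power_poly a * power_poly b) f) rmorphD rmorphM /= f0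
  mulr0 add0r.
Qed.

End PowerBasis.

Lemma size_monic_tail (R : nzRingType) (n : nat) (f : {poly R}) :
  f \is monic -> size f = n.+1 -> (size ('X^n - f)%R <= n)%N.
Proof.
move=> f_monic sf; apply/leq_sizeP => j; rewrite coefB coefXn leq_eqVlt.
move=> /predU1P[<-|nj]; last first.
  by rewrite gtn_eqF // nth_default ?subr0 // sf.
by rewrite eqxx; move/monicP: f_monic; rewrite lead_coefE sf /= => ->;
  rewrite subrr.
Qed.

Lemma quo_mulE (K : finFieldType) (h : {poly K}) (hI : irreducible_poly h)
    (a b : quo hI) :
  polyn (a * b) = ((a : {poly K}) * (b : {poly K})) %% monicize h.
Proof.
rewrite [LHS]poly_of_qpolyM -Pdiv.IdomainMonic.modpE ?monic_mk_monic //.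
by congr (_ %% _); apply: mk_monic_monicize.
Qed.

Section Programs.
Local Open Scope cset_scope.
Variables (P : params) (I : Type) (D : I -> input P) (Mc : nat -> nat).
Local Notation q := (q P).
Local Notation r := (r P).
Local Notation l := (l P).
Local Notation s := (s P).
Local Notation F := 'F_(Defs.q P).
Local Notation K i := (finvect_type (k (D i))).
Local Notation k' i := (quo (h_irr (D i))).
Local Notation cdF := (fun u : I -> F => csing u).

Hypothesis polyMF : forall m X (p p' : I -> {poly F}), (0 < m)%N ->
  (forall i, (size (p i) <= m)%N) -> (forall i, (size (p' i) <= m)%N) ->
  known X (pcode (R := fun=> F) cdF p) ->
  known X (pcode (R := fun=> F) cdF p') ->
  reach X (Mc m) (pcode (R := fun=> F) cdF (fun i => p i * p' i)).

Definition rep i (a : K i) : {poly F} := power_poly (x (D i)) r (a : k (D i)).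
Arguments rep : clear implicits.

Lemma size_rep i a : (size (rep i a) <= r)%N.
Proof. exact: size_power_poly. Qed.

Lemma rep0 i : rep i 0 = 0.
Proof. exact: (power_poly0 (k_degree (D i)) (x_gen (D i))). Qed.

Lemma rep1 i : rep i 1 = 1.
Proof. exact: (power_poly1 (k_degree (D i)) (x_gen (D i))). Qed.

Lemma repD i a b : rep i (a + b) = rep i a + rep i b.
Proof. exact: (power_polyD (k_degree (D i)) (x_gen (D i))). Qed.

Lemma repB i a b : rep i (a - b) = rep i a - rep i b.
Proof. exact: (power_polyB (k_degree (D i)) (x_gen (D i))). Qed.

(** X^r - phi is the minimal polynomial of the generator x. *)
Definition phi i : {poly F} := rep i (x (D i) ^+ r).

Lemma repM i a b : rep i (a * b) = (rep i a * rep i b) %% ('X^r - phi i).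
Proof. exact: (power_polyM (k_degree (D i)) (x_gen (D i))). Qed.

Lemma coords_rep i (a : K i) : coords a = [seq (rep i a)`_j | j <- iota 0 r].
Proof.
have sc : size (coords a) = r by rewrite size_map size_enum_ord.
rewrite (eq_map (g := nth 0 (coords a))) => [|j]; last by rewrite coef_Poly.
by rewrite map_nth_iota0 ?sc // -sc take_size.
Qed.

Let r_gt0 : (0 < r)%N := (rs_gt0 P).1.
Let s_gt0 : (0 < s)%N := (rs_gt0 P).2.

Definition cdK (u : forall i, K i) : cset (I -> F) :=
  pcode (R := fun=> F) cdF (fun i => rep i (u i)).

Definition tableK : cset (I -> F) := cempty
  `|` pcode (R := fun=> F) cdF phi
  `|` pcode (R := fun=> F) cdF (barrett_inverse (R := fun=> F) r phi).

Definition costK := (3 * Mc r + r * 1)%N.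

Lemma codedK : coded tableK (R := fun i => K i) cdK (r * 1) costK.
Proof.
apply: (coded_kronecker (K := fun i => K i) (rep := rep)) => //.
- by move=> i; apply: size_rep.
- exact: rep0.
- exact: rep1.
- exact: size_rep.
- exact: repD.
- exact: repB.
- exact: repM.
Qed.

Definition costKP := (Mc (2 * r * s) + 2 * s * (2 * Mc r + r))%N.

Lemma polyMK X (p p' : forall i, {poly K i}) : known X tableK ->
  (forall i, (size (p i) <= s)%N) -> (forall i, (size (p' i) <= s)%N) ->
  known X (pcode (R := fun i => K i) cdK p) ->
  known X (pcode (R := fun i => K i) cdK p') ->
  reach X costKP (pcode (R := fun i => K i) cdK (fun i => p i * p' i)).
Proof.
apply: (reach_kronecker (K := fun i => K i) (rep := rep)) => //.
- by move=> i; apply: size_rep.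
- exact: rep0.
- exact: rep1.
- exact: size_rep.
- exact: repD.
- exact: repB.
- exact: repM.
Qed.

Definition Phi i : {poly K i} := 'X^s - monicize (h (D i)).

Lemma size_Phi i : (size (Phi i) <= s)%N.
Proof.
have [_ hm] := monicize_irreducible (h_irr (D i)).
by apply: size_monic_tail; rewrite // (size_monicize (h_irr _)) h_size.
Qed.

Definition tablek' : cset (I -> F) := tableK
  `|` pcode (R := fun i => K i) cdK Phi
  `|` pcode (R := fun i => K i) cdK (barrett_inverse (R := fun i => K i) s Phi).

Definition cdk' (u : forall i, k' i) : cset (I -> F) :=
  pcode (R := fun i => K i) cdK (fun i => (u i : {poly K i})).

Definition adk' := (s * (r * 1))%N.
Definition costk' := (3 * costKP + s * (r * 1))%N.

Lemma codedk' : coded tablek' (R := fun i => k' i) cdk' adk' costk'.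
Proof.
apply: (coded_quotient (Q := fun i => k' i) codedK s_gt0 size_Phi polyMK
  (rep := fun i (a : k' i) => (a : {poly K i}))) => // i a.
  by have := size_quo a; rewrite h_size.
by move=> b; rewrite /Phi subKr quo_mulE.
Qed.
End Programs.

(** * The six tasks *)

Section Tasks.
Local Open Scope cset_scope.
Variables (P : params) (I : Type) (D : I -> input P) (Mc : nat -> nat).
Local Notation q := (q P).
Local Notation r := (r P).
Local Notation l := (l P).
Local Notation s := (s P).
Local Notation F := 'F_(Defs.q P).
Local Notation K i := (finvect_type (k (D i))).
Local Notation k' i := (quo (h_irr (D i))).
Local Notation cdF := (fun u : I -> F => csing u).

Hypothesis polyMF : forall m X (p p' : I -> {poly F}), (0 < m)%N ->
  (forall i, (size (p i) <= m)%N) -> (forall i, (size (p' i) <= m)%N) ->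
  known X (pcode (R := fun=> F) cdF p) ->
  known X (pcode (R := fun=> F) cdF p') ->
  reach X (Mc m) (pcode (R := fun=> F) cdF (fun i => p i * p' i)).

Variable tq : nat.
Hypothesis q_lt : (q < 2 ^ tq)%N.

Local Notation cd := (cdk' (D := D)).
Local Notation ca := (adk' P).
Local Notation cm := (costk' P Mc).
Local Notation te := (r * s * tq)%N.

Let C : coded (tablek' D) (R := fun i => k' i) cd ca cm := @codedk' P I D Mc
  polyMF.
Let r_gt0 : (0 < r)%N := (rs_gt0 P).1.
Let s_gt0 : (0 < s)%N := (rs_gt0 P).2.

Lemma q_exp_lt n : (0 < n)%N -> (q ^ n < 2 ^ (n * tq))%N.
Proof. by move=> n_gt0; rewrite mulnC expnM ltn_exp2r. Qed.

Variables (X : cset (I -> F)) (y : forall i, k' i).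
Hypotheses (kT : known X (tablek' D)) (ky : known X (cd y)).

Lemma reach_natr2 Z : reach Z ca (cd (fun i => 2%:R)).
Proof.
apply: (reach_eq (R := fun i => k' i) (cd := cd) (v := fun i => 1 + 1)) => //.
by apply: (codedD C (u := fun=> 1) (v := fun=> 1)); apply: known_set0;
  apply: (coded1 C).
Qed.

Lemma reach_not_two : reach X (ca + ca) (cd (fun i => y i - 2%:R)).
Proof.
apply: (reach_bind (reach_natr2 X)).
apply: (codedB C (u := y) (v := fun=> 2%:R)); first exact: known_left.
exact: known_right.
Qed.

Lemma reach_residuosity :
  reach X (ca + (ca + (cm + (ca + (te * (2 * cm) + ca)))))
    (cd (fun i => (y i ^+ 2 - 4%:R) ^+ (q ^ (r * s)).-1./2 + 1)).
Proof.
apply: (reach_bind (reach_natr2 X)); set X1 := X `|` _.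
have [kT1 ky1] : known X1 (tablek' D) /\ known X1 (cd y).
  by split; apply: known_left.
have k2 : known X1 (cd (fun i => 2%:R)) by apply: known_right.
apply: (@reach_bind _ _ (cd (fun i => 4%:R))).
  apply: (reach_eq (R := fun i => k' i) (cd := cd)
    (v := fun i => 2%:R + 2%:R)) => [|i]; last by rewrite -natrD.
  exact: (codedD C (u := fun=> 2%:R) (v := fun=> 2%:R)).
set X2 := X1 `|` _.
have [kT2 ky2] : known X2 (tablek' D) /\ known X2 (cd y).
  by split; apply: known_left.
have k4 : known X2 (cd (fun i => 4%:R)) by apply: known_right.
apply: (@reach_bind _ _ (cd (fun i => y i * y i))).
  exact: (codedM C (u := y) (v := y)).
set X3 := X2 `|` _; have kT3 : known X3 (tablek' D) by apply: known_left.
apply: (@reach_bind _ _ (cd (fun i => y i ^+ 2 - 4%:R))).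
  apply: (codedB C (u := fun i => y i ^+ 2) (v := fun=> 4%:R)).
    exact: known_right.
  exact: known_left.
set X4 := X3 `|` _; have kT4 : known X4 (tablek' D) by apply: known_left.
apply: (@reach_bind _ _
  (cd (fun i => (y i ^+ 2 - 4%:R) ^+ (q ^ (r * s)).-1./2))).
  apply: (coded_exp C (u := fun i => y i ^+ 2 - 4%:R)) => //.
    apply: leq_ltn_trans (q_exp_lt _); last by rewrite muln_gt0 r_gt0.
    by move: (q ^ _)%N => c; lia.
  exact: known_right.
apply: (codedD C (u := fun i => (y i ^+ 2 - 4%:R) ^+ (q ^ (r * s)).-1./2)
  (v := fun=> 1)); first exact: known_right.
exact: known_set0 (coded1 C).
Qed.

Lemma reach_zeta : reach X (ca + te * (2 * cm + 2 * ca))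
  (cd (fun i => zeta_of (y i))).
Proof.
apply: (reach_eq (R := fun i => k' i) (cd := cd)
  (v := fun i => bracket ((q ^ (r * s) + 1) %/ l) (y i))) => [|i]; last first.
  by rewrite /zeta_of card_k'.
apply: (coded_bracket C) => //.
apply: leq_ltn_trans (q_exp_lt _); last by rewrite muln_gt0 r_gt0.
have : (0 < q ^ (r * s))%N by rewrite expn_gt0 prime_gt0 ?q_prime.
move: (q ^ _)%N => c c_gt0.
rewrite -ltnS ltn_divLR ?(ltnW (l_gt1 P)) //; have := l_gt1 P; nia.
Qed.

(** The trace is obtained as the sum of s conjugates, each the q^r-th power of the previous one, and
    not from the matrix that defines it. The result is a constant of k'. *)
Lemma reach_trace : reach X (s * (r * tq * (2 * cm)) + s * ca)
  (cd (fun i => (quo_trace (y i))%:A)).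
Proof.
pose b j i : k' i := y i ^+ ((q ^ r) ^ j).
apply: (@reach_bind _ _ (cfamn s.+1 (fun j => cd (b j)))).
  apply: reach_iter => [|j _].
    by apply: (known_eq (R := fun i => k' i) (cd := cd) ky) => i;
      rewrite /b expr1.
  apply: (reach_eq (R := fun i => k' i) (cd := cd)
    (v := fun i => b j i ^+ (q ^ r))) => [|i].
    apply: (coded_exp C); [exact: q_exp_lt | exact: known_left |].
    exact: known_right.
  by rewrite /b -exprM expnSr.
apply: (reach_eq (R := fun i => k' i) (cd := cd)
  (v := fun i => \sum_(j < s) b j i)) => [|i].
  apply: (coded_sum C) => j js; apply: known_sub (@known_right _ _ X _).
  by move=> z bz; exists j => //=; apply: ltnW.
rewrite (quo_trace_frobenius (q_prime P) (card_k (D i))) h_size.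
by apply: eq_bigr => j _; rewrite card_k.
Qed.

Lemma reach_eta tl : (l < 2 ^ tl)%N ->
  reach X (#|Sgrp P| * (ca + tl * (2 * cm + 2 * ca)) + #|Sgrp P| * ca)
    (cd (fun i => eta (y i))).
Proof.
move=> l_lt.
pose b j i : k' i :=
  bracket (FinRing.uval (nth 1%g (enum (Sgrp P)) j) : 'Z_l) (y i).
apply: (@reach_bind _ _ (cfamn #|Sgrp P| (fun j => cd (b j)))).
  apply: reach_bigcup => j _; apply: (coded_bracket C) => //.
  apply: ltn_trans l_lt; apply: leq_trans (ltn_ord _) _.
  by rewrite Zp_cast ?l_gt1.
apply: (reach_eq (R := fun i => k' i) (cd := cd)
  (v := fun i => \sum_(j < #|Sgrp P|) b j i)) => [|i].
  apply: (coded_sum C) => j jS; apply: known_sub (@known_right _ _ X _).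
  by move=> z bz; exists j.
rewrite /eta -big_enum (big_nth 1%g) big_mkord /=.
by rewrite -cardE.
Qed.

End Tasks.

(** * The precomputed tables of k and k' *)

Section Construct.
Local Open Scope cset_scope.
Variables (P : params) (I : Type) (D : I -> input P) (Mc : nat -> nat).
Local Notation q := (q P).
Local Notation r := (r P).
Local Notation l := (l P).
Local Notation s := (s P).
Local Notation F := 'F_(Defs.q P).
Local Notation K i := (finvect_type (k (D i))).
Local Notation cdF := (fun u : I -> F => csing u).

Hypothesis polyMF : forall m X (p p' : I -> {poly F}), (0 < m)%N ->
  (forall i, (size (p i) <= m)%N) -> (forall i, (size (p' i) <= m)%N) ->
  known X (pcode (R := fun=> F) cdF p) ->
  known X (pcode (R := fun=> F) cdF p') ->
  reach X (Mc m) (pcode (R := fun=> F) cdF (fun i => p i * p' i)).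

Variable tq : nat.
Hypothesis q_lt : (q < 2 ^ tq)%N.
Let r_gt0 : (0 < r)%N := (rs_gt0 P).1.
Let s_gt0 : (0 < s)%N := (rs_gt0 P).2.
Let C : coded (tableK D) (R := fun i => K i) (cdK (D := D)) (r * 1) (costK P Mc)
  := @codedK P I D Mc polyMF.
Local Notation cK := (costK P Mc).

(** The inverse of the leading coefficient is its power of exponent [#|R| - 2]. The form [0 - _] is
    used because [coded] provides differences but no opposites. *)
Lemma monicizeE (R : finFieldType) (h : {poly R}) n j :
  (1 < #|R|)%N -> size h = n.+1 ->
  ('X^n - monicize h)`_j
  = if (j < n)%N then 0 - h`_n ^+ (#|R| - 2) * h`_j else 0.
Proof.
move=> R_gt1 sh; have hn : h`_n = lead_coef h by rewrite lead_coefE sh.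
have h0 : h`_n != 0 by rewrite hn lead_coef_eq0 -size_poly_eq0 sh.
have hV : h`_n ^+ (#|R| - 2) = (h`_n)^-1.
  apply: (mulfI h0); rewrite divff // -exprS; apply: (mulfI h0).
  by rewrite mulr1 -exprS -[RHS]expf_card; congr (_ ^+ _); lia.
rewrite coefB coefXn coefZ -hn hV; case: ltngtP => [jn|nj|->]; rewrite ?eqxx //.
- have -> : h`_j = 0 by rewrite nth_default ?sh.
  by rewrite mulr0 subrr.
- by rewrite mulVf // subrr.
Qed.

(** The four summands pay for the Barrett inverse of k over F_q, the Fermat inversion of the leading
    coefficient of h, the s coefficients of [Phi], and the Barrett inverse of k' over k. *)
Lemma reach_table X :
  known X (cdK (fun i => x (D i) ^+ r)) ->
  (forall j, known X (cdK (fun i => (h (D i))`_j))) ->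
  reach X (2 * r * (r * 2) + (r * tq * (2 * cK) + (s * (cK + r * 1)
           + 2 * s * (s * (cK + r * 1)))))
    (tablek' D).
Proof.
move=> kphi kh.
have rK : reach X (2 * r * (r * 2)) (tableK D).
  apply: reach_sub (reach_keep (reach_barrett_inverse (R := fun=> F)
    (coded_base F I) r_gt0 (fun i => size_rep _) _ kphi)) => //.
  apply: knownU; last exact: known_right.
  by apply: knownU => //; apply: known_left.
apply: (reach_bind rK); set X1 := X `|` _.
have kT : known X1 (tableK D) by apply: known_right.
have kh1 j : known X1 (cdK (fun i => (h (D i))`_j)) by apply: known_left.
apply: (@reach_bind _ _ (cdK (fun i => (h (D i))`_s ^+ (q ^ r - 2)))).
  apply: (coded_exp C (u := fun i => (h (D i))`_s)) => //.
  by apply: leq_ltn_trans (q_exp_lt q_lt r_gt0); apply: leq_subr.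
set X2 := X1 `|` _.
have kT2 : known X2 (tableK D) by apply: known_left.
have kh2 j : known X2 (cdK (fun i => (h (D i))`_j)) by apply: known_left.
have kV : known X2 (cdK (fun i => (h (D i))`_s ^+ (q ^ r - 2))).
  exact: known_right.
have PhiE i j : (Phi D i)`_j = if (j < s)%N
    then 0 - (h (D i))`_s ^+ (q ^ r - 2) * (h (D i))`_j else 0.
  by rewrite monicizeE ?finNzRing_gt1 ?h_size // card_k.
apply: (@reach_bind _ _ (pcode (R := fun i => K i) (cdK (D := D)) (Phi D))).
  apply: (pcode_reach C) => [i|j js]; first exact: size_Phi.
  apply: (@reach_bind _ _
    (cdK (fun i => (h (D i))`_s ^+ (q ^ r - 2) * (h (D i))`_j))).
    exact: (codedM C (u := fun i => (h (D i))`_s ^+ (q ^ r - 2))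
      (v := fun i => (h (D i))`_j)).
  apply: (reach_eq (R := fun i => K i) (cd := cdK (D := D)) (v := fun i =>
    0 - (h (D i))`_s ^+ (q ^ r - 2) * (h (D i))`_j)) => [|i]; last first.
    by rewrite PhiE js.
  apply: (codedB C (u := fun=> 0) (v := fun i =>
    (h (D i))`_s ^+ (q ^ r - 2) * (h (D i))`_j)); last exact: known_right.
  exact: known_set0 (coded0 C).
set X3 := X2 `|` _.
have kT3 : known X3 (tableK D) by apply: known_left.
have kPhi : known X3 (pcode (R := fun i => K i) (cdK (D := D)) (Phi D)).
  exact: known_right.
apply: reach_sub (reach_keep (reach_barrett_inverse (R := fun i => K i) C s_gt0
  (size_Phi D) kT3 kPhi)).
apply: knownU; last exact: known_right.
by apply: knownU; apply: known_left.
Qed.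

End Construct.

(** * From cells to programs *)

Section SlpPolyM.
Local Open Scope cset_scope.
Variables (F : fieldType) (I : Type).
Local Notation cdF := (fun u : I -> F => csing u).

Definition flist n (p : I -> {poly F}) : seq (I -> F) :=
  [seq (fun i => (p i)`_j) | j <- iota 0 n].

Lemma flist_known n (p : I -> {poly F}) : (forall i, (size (p i) <= n)%N) ->
  known (clist (flist n p)) (pcode (R := fun=> F) cdF p).
Proof.
move=> sp; apply/pcode_known => j _ ->; have [jn|nj] := ltnP j n.
  by left; apply/clist_mkseq; exists j.
right; left; apply/funext => i.
by rewrite nth_default // (leq_trans (sp i)).
Qed.

Lemma known_flist n (p : I -> {poly F}) :
  known (pcode (R := fun=> F) cdF p) (clist (flist n p)).
Proof. by move=> z /clist_mkseq[j _ ->]; left; exists j. Qed.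

Lemma slp_polyM (A : slp) m : (0 < m)%N ->
  (forall a b : {poly F}, (size a <= m)%N -> (size b <= m)%N ->
    slp_run A (mkseq (nth 0 a) m ++ mkseq (nth 0 b) m) =
    Some (mkseq (nth 0 (a * b)) (2 * m).-1)) ->
  forall X (p p' : I -> {poly F}),
  (forall i, (size (p i) <= m)%N) -> (forall i, (size (p' i) <= m)%N) ->
  known X (pcode (R := fun=> F) cdF p) ->
  known X (pcode (R := fun=> F) cdF p') ->
  reach X (slp_cost A) (pcode (R := fun=> F) cdF (fun i => p i * p' i)).
Proof.
move=> m_gt0 AE X p p' sp sp' kp kp'.
have run i : slp_run A [seq c i | c : I -> F <- flist m p ++ flist m p']
    = Some (mkseq (nth 0 (p i * p' i)) (2 * m).-1).
  by rewrite -AE // map_cat -!map_comp.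
have kX : known X (clist (flist m p ++ flist m p')).
  move=> z /clist_cat[] z_in.
    exact: (known_trans kp (@known_flist m p) z_in).
  exact: (known_trans kp' (@known_flist m p') z_in).
apply: (reach_weak kX); apply: reach_sub (slp_reach run).
apply/pcode_known => j _ ->; have [jm|mj] := ltnP j (2 * m).-1.
  by left; exists j; apply/funext => i; rewrite nth_mkseq.
right; left; apply/funext => i; rewrite nth_default //.
apply: leq_trans (size_polyMleq _ _) (leq_trans _ mj).
by rewrite -!subn1 leq_sub2r // mul2n -addnn leq_add.
Qed.

End SlpPolyM.

Section Lists.
Local Open Scope cset_scope.
Variables (P : params) (I : Type) (D : I -> input P).
Local Notation r := (r P).
Local Notation s := (s P).
Local Notation F := 'F_(Defs.q P).
Local Notation K i := (finvect_type (k (D i))).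
Local Notation k' i := (quo (h_irr (D i))).
Local Notation cdF := (fun u : I -> F => csing u).

Definition klist (u : forall i, K i) : seq (I -> F) :=
  flist r (fun i => rep (u i)).

Lemma klist_coords (u : forall i, K i) i :
  [seq c i | c : I -> F <- klist u] = coords (u i).
Proof. by rewrite coords_rep -map_comp. Qed.

Lemma klist_known (u : forall i, K i) : known (clist (klist u)) (cdK u).
Proof. by apply: flist_known => i; apply: size_rep. Qed.

Lemma known_klist (u : forall i, K i) : known (cdK u) (clist (klist u)).
Proof. exact: known_flist. Qed.

Definition plist n (p : forall i, {poly K i}) : seq (I -> F) :=
  flatten [seq klist (fun i => (p i)`_j) | j <- iota 0 n].

Lemma plist_coords n (p : forall i, {poly K i}) i :
  [seq c i | c : I -> F <- plist n p]
  = flatten [seq coords (p i)`_j | j <- iota 0 n].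
Proof.
rewrite map_flatten -map_comp; congr flatten; apply: eq_map => j /=.
exact: klist_coords.
Qed.

Lemma plist_known n (p : forall i, {poly K i}) :
  (forall i, (size (p i) <= n)%N) ->
  known (clist (plist n p)) (pcode (R := fun i => K i) (cdK (D := D)) p).
Proof.
move=> sp; apply/pcode_known => j; have [jn|nj] := ltnP j n.
  have kj : known (clist (plist n p)) (clist (klist (fun i => (p i)`_j))).
    by move=> z zj; left; apply/clist_flatten; exists j.
  exact: (known_trans kj (@klist_known (fun i => (p i)`_j))).
apply: known_set0; apply: (known_eq (R := fun i => K i) (cd := cdK (D := D))
  (v := fun=> 0)) => [|i]; last by rewrite nth_default // (leq_trans (sp i)).
apply/pcode_known => m _ ->; right; left; apply/funext => i.
by rewrite rep0 coef0.
Qed.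

Lemma known_plist n (p : forall i, {poly K i}) :
  known (pcode (R := fun i => K i) (cdK (D := D)) p) (clist (plist n p)).
Proof.
move=> z /clist_flatten[j _ zj].
have kj : known (pcode (R := fun i => K i) (cdK (D := D)) p)
    (cdK (fun i => (p i)`_j)) by move=> w wj; left; exists j.
exact: (known_trans kj (@known_klist (fun i => (p i)`_j)) zj).
Qed.

Definition tlist : seq (I -> F) :=
  flist r (phi D) ++ flist r (barrett_inverse (R := fun=> F) r (phi D))
  ++ plist s (Phi D)
  ++ plist s (barrett_inverse (R := fun i => K i) s (Phi D)).

Let r_gt0 : (0 < r)%N := (rs_gt0 P).1.
Let s_gt0 : (0 < s)%N := (rs_gt0 P).2.

Lemma tlist_known : known (clist (tlist)) (tablek' D).
Proof.
have kl (a b : seq (I -> F)) Y : known (clist (a)) Y -> known (clist (a ++ b))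
  Y.
  by apply: knownW => z za; apply/clist_cat; left.
have kr (a b : seq (I -> F)) Y : known (clist (b)) Y -> known (clist (a ++ b))
  Y.
  by apply: knownW => z zb; apply/clist_cat; right.
apply: knownU; first apply: knownU; first apply: knownU; first apply: knownU.
- by [].
- by apply: kl; apply: flist_known => i; apply: size_rep.
- apply: kr; apply: kl; apply: flist_known => i.
  by apply: size_barrett_inverse => //; apply: size_rep.
- by do 2!apply: (kr); apply: kl; apply: plist_known => i; apply: size_Phi.
- do 3!apply: (kr); apply: plist_known => i.
  by apply: size_barrett_inverse => //; apply: size_Phi.
Qed.

Lemma known_tlist : known (tablek' D) (clist (tlist)).
Proof.
move=> z /clist_cat[z_in|/clist_cat[z_in|/clist_cat[z_in|z_in] ] ].
- apply: (knownW _ (known_flist (n := r) (p := phi D)) z_in).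
  by move=> w ?; left; left; left; right.
- apply: (knownW _ (known_flist (n := r)
    (p := barrett_inverse (R := fun=> F) r (phi D))) z_in).
  by move=> w ?; left; left; right.
- by apply: (knownW _ (@known_plist s (Phi D)) z_in) => w ?; left; right.
- apply: (knownW _ (@known_plist s
    (barrett_inverse (R := fun i => K i) s (Phi D))) z_in) => w ?.
  by right.
Qed.

Lemma coords'_list (y : forall i, k' i) i :
  [seq c i | c : I -> F <- plist s (fun i => (y i : {poly K i}))] = coords' (y
    i).
Proof. by rewrite plist_coords. Qed.

End Lists.

(** [Construct] runs over inputs, the other tasks over pairs of an input and an element; the table
    depends on the input alone, so what the first leaves is what the others read. *)
Lemma tlist_reindex (P : params) (I : Type) (D : I -> input P) i :
  [seq c i | c <- tlist D] = [seq c (D i) | c <- tlist id].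
Proof.
rewrite /tlist !map_cat !plist_coords; congr (_ ++ (_ ++ _));
  by rewrite -!map_comp.
Qed.

Lemma coords'_eq0 (P : params) (D : input P) (a : quo (h_irr D)) :
  all (pred1 0) (coords' a) = (a == 0).
Proof.
apply/idP/eqP => [/allP a0|->]; last first.
  apply/allP => c /flattenP[_ /mapP[j _ ->] ].
  rewrite coef0 (coords_rep (D := fun _ : unit => D) (i := tt)).
  by move=> /mapP[m _ ->]; rewrite rep0 coef0 /=.
apply: val_inj; apply/polyP => j; rewrite [RHS]coef0.
have [js|sj] := ltnP j (s P); last first.
  by rewrite nth_default // (leq_trans (size_quo a)) // h_size.
pose u := (polyn a)`_j : finvect_type (k D).
have u0 : power_poly (x D) (r P) (u : k D) = 0.
  apply/polyP => m; rewrite coef0.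
  have [mr|rm] := ltnP m (r P); last first.
    by rewrite nth_default // (leq_trans (size_power_poly _ _ _)).
  apply/eqP; apply: a0; apply/flatten_mapP; exists j; rewrite ?mem_iota //.
  rewrite (coords_rep (D := fun _ : unit => D) (i := tt)).
  by apply/mapP; exists m; rewrite ?mem_iota.
by rewrite -[LHS](horner_power_poly (k_degree D) (x_gen D)) u0 rmorph0.
Qed.

Section Implementation.
Variables (P : params) (Am : nat -> slp) (tq tl : nat).
Local Open Scope cset_scope.
Local Notation q := (q P).
Local Notation r := (r P).
Local Notation l := (l P).
Local Notation s := (s P).
Local Notation F := 'F_(Defs.q P).

Hypothesis AmE : forall m, (0 < m)%N -> forall a b : {poly F},
  (size a <= m)%N -> (size b <= m)%N ->
  slp_run (Am m) (mkseq (nth 0 a) m ++ mkseq (nth 0 b) m) =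
  Some (mkseq (nth 0 (a * b)) (2 * m).-1).
Hypotheses (q_lt : (q < 2 ^ tq)%N) (l_lt : (l < 2 ^ tl)%N).

Local Notation Mc := (fun m => slp_cost (Am m)).
Local Notation ca := (adk' P).
Local Notation cm := (costk' P Mc).
Local Notation cK := (costK P Mc).
Local Notation te := (r * s * tq)%N.

Definition task_bound (t : task) : nat :=
  match t with
  | Construct => 2 * r * (r * 2) + (r * tq * (2 * cK) + (s * (cK + r * 1)
      + 2 * s * (s * (cK + r * 1))))
  | Residuosity => ca + (ca + (cm + (ca + (te * (2 * cm) + ca))))
  | Zeta => ca + te * (2 * cm + 2 * ca)
  | NotTwo => ca + ca
  | Eta => #|Sgrp P| * (ca + tl * (2 * cm + 2 * ca)) + #|Sgrp P| * ca
  | Trace => s * (r * tq * (2 * cm)) + s * ca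
  end.

Lemma polyM_Am (I : Type) m X (p p' : I -> {poly F}) : (0 < m)%N ->
  (forall i, (size (p i) <= m)%N) -> (forall i, (size (p' i) <= m)%N) ->
  known X (pcode (R := fun=> F) (fun u : I -> F => csing u) p) ->
  known X (pcode (R := fun=> F) (fun u : I -> F => csing u) p') ->
  reach X (Mc m)
    (pcode (R := fun=> F) (fun u : I -> F => csing u) (fun i => p i * p' i)).
Proof. by move=> m_gt0; apply: slp_polyM (AmE m_gt0) _ _ _. Qed.

Definition table_coords (D : input P) : seq F :=
  [seq c D | c : input P -> F <- tlist id].

Lemma construct_slp : exists2 p, (slp_cost p <= task_bound Construct)%N &
  forall D : input P, slp_run p (input_coords D) = Some (table_coords D).
Proof.
pose D (i : input P) := i.
pose u i : finvect_type (k (D i)) := x i ^+ r.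
pose f i : {poly finvect_type (k (D i))} := h i.
pose xs := klist u ++ plist s.+1 f.
have kx : known (clist xs) (cdK u).
  by apply: (knownW _ (@klist_known _ _ _ u)) => z zu; apply/clist_cat; left.
have kh j : known (clist xs) (cdK (fun i => (f i)`_j)).
  have : known (clist xs) (pcode (R := fun i => finvect_type (k (D i))) (cdK (D
    := D)) f).
    have kf : known (clist (plist s.+1 f)) (pcode (R := fun i => finvect_type
      (k (D i))) (cdK (D := D)) f).
      by apply: plist_known => i; rewrite h_size.
    by apply: (knownW _ (kf)) => z zf; apply/clist_cat; right.
  by move/pcode_known.
have rT := reach_table (D := D) (Mc := Mc) (@polyM_Am _) q_lt kx kh.
have [p p_cost pE] := reach_slp (reach_sub (known_tlist (D := D)) rT).
exists p => // i; rewrite -pE /input_coords map_cat klist_coords.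
by rewrite plist_coords.
Qed.

(** Runs are indexed by an input together with an element of its k', so that a single program is
    obtained for all of them. *)
Let I := {D : input P & quo (h_irr D)}.
Let D (i : I) : input P := projT1 i.
Let y (i : I) : quo (h_irr (D i)) := projT2 i.
Let kl (w : forall i, quo (h_irr (D i))) :=
  plist s (fun i => (w i : {poly finvect_type (k (D i))})).

Lemma kl_known w : known (clist (kl w)) (cdk' w).
Proof.
by apply: plist_known => i; have := size_quo (w i); rewrite h_size.
Qed.

Lemma task_slp c (ys : seq (I -> F)) Y :
  (forall X, known X (tablek' D) -> known X (cdk' y) -> reach X c Y) ->
  known Y (clist ys) ->
  exists2 p, (slp_cost p <= c)%N & forall (D0 : input P) (t : quo (h_irr D0)),
    slp_run p (table_coords D0 ++ coords' t)
    = Some [seq z (existT (fun D => quo (h_irr D)) D0 t) | z : I -> F <- ys].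
Proof.
move=> rY kY; pose xs := tlist D ++ kl y.
have {}rY : reach (clist xs) c (clist ys).
  apply: reach_sub kY _; apply: rY.
    by apply: (knownW _ (@tlist_known _ _ D)) => z zt; apply/clist_cat; left.
  by apply: (knownW _ (@kl_known y)) => z zt; apply/clist_cat; right.
have [p p_cost pE] := reach_slp rY; exists p => // D0 t.
by rewrite -pE map_cat tlist_reindex coords'_list.
Qed.

Lemma known_kl w : known (cdk' w) (clist (kl w)).
Proof. exact: known_plist. Qed.

Lemma task_slp_coords c (w : forall i, quo (h_irr (D i))) :
  (forall X, known X (tablek' D) -> known X (cdk' y) -> reach X c (cdk' w)) ->
  exists2 p, (slp_cost p <= c)%N & forall (D0 : input P) (t : quo (h_irr D0)),
    slp_run p (table_coords D0 ++ coords' t)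
    = Some (coords' (w (existT (fun D => quo (h_irr D)) D0 t))).
Proof.
move=> rw; have [p p_cost pE] := task_slp rw (@known_kl w).
by exists p => // D0 t; rewrite pE coords'_list.
Qed.

Lemma residuosityE (D0 : input P) (t : quo (h_irr D0)) :
  (((t ^+ 2 - 4%:R) ^+ (q ^ (r * s)).-1./2 + 1 == 0)
   = nonresidue (t ^+ 2 - 4%:R)).
Proof. by rewrite nonresidueE ?two_neq0_k' // card_k' addr_eq0. Qed.

Lemma implementation : exists A : task -> slp,
  (forall D : input P, implements D A) /\
  (forall t, (slp_cost (A t) <= task_bound t)%N).
Proof.
have poly := @polyM_Am I.
have [p0 c0 E0] := construct_slp.
have [p1 c1 E1] := task_slp_coords (fun X kT ky =>
  reach_residuosity poly q_lt kT ky).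
have [p2 c2 E2] := task_slp_coords (fun X kT ky =>
  reach_zeta poly q_lt kT ky).
have [p3 c3 E3] := task_slp_coords (fun X kT ky => reach_not_two poly ky).
have [p4 c4 E4] := task_slp_coords (fun X kT ky =>
  reach_eta poly kT ky l_lt).
(* The trace was computed as a constant of k'; its coordinates in k are those of the coefficient of
   Z^0. *)
have kt (u : forall i, finvect_type (k (D i))) :
    known (cdk' (fun i => (u i)%:A : quo (h_irr (D i)))) (clist (klist u)).
  have kc := pcode_coef_known (j := 0%N)
    (@known_refl _ _ (cdk' (fun i => (u i)%:A : quo (h_irr (D i))))).
  apply: known_trans (@known_klist _ _ _ u).
  apply: (known_eq (R := fun i => finvect_type (k (D i))) (cd := cdK (D := D))
    kc).
  by move=> i; rewrite -[polyn _]/(u i *: 1) alg_polyC coefC.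
have [p5 c5 E5] := task_slp (fun X kT ky => reach_trace poly q_lt kT ky)
  (kt (fun i => quo_trace (y i))).
exists (fun t => match t with Construct => p0 | Residuosity => p1 | Zeta => p2
  | NotTwo => p3 | Eta => p4 | Trace => p5 end).
split=> [D0|[] //]; exists (table_coords D0); first exact: E0.
split=> t.
- by eexists; [exact: E1 | rewrite coords'_eq0 residuosityE].
- exact: E2.
- by eexists; [exact: E3 | rewrite coords'_eq0 subr_eq0].
- exact: E4.
- by rewrite E5 klist_coords.
Qed.

End Implementation.

(** * Complexity *)

Section Logarithm.
Variable R : realType.

Lemma ln_le (x y : R) : 0 < x -> x <= y -> ln x <= ln y.
Proof. by move=> x0 xy; rewrite ler_ln // posrE // (lt_le_trans x0). Qed.

(** From ln (1 + y) <= y at y = -1/2. *)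
Lemma ln2_ge : 2^-1 <= ln 2%:R :> R.
Proof.
have h := @le_ln1Dx R (- 2^-1) ltac:(lra).
have e : 1 + - 2^-1 = 2^-1 :> R by lra.
by move: h; rewrite e lnV ?posrE ?ltr0n // lerN2.
Qed.

Lemma ln_nat_ge (n : nat) : (1 < n)%N -> 2^-1 <= ln n%:R :> R.
Proof.
by move=> n1; apply: le_trans ln2_ge _; apply: ln_le; rewrite ?ltr0n ?ler_nat.
Qed.

(** With ln 2 >= 1/2, the truncated logarithm and the added 1 are each at most 2 ln n. *)
Lemma trunc_log_ln (n : nat) : (1 < n)%N ->
  (trunc_log 2 n).+1%:R <= 4%:R * ln n%:R :> R.
Proof.
move=> n1; set t := trunc_log 2 n.
have tn : (2 ^ t <= n)%N by apply: trunc_logP => //; apply: ltnW.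
have : ln (2%:R ^+ t) <= ln n%:R :> R.
  by apply: ln_le; rewrite -natrX ?ltr0n ?expn_gt0 ?ler_nat.
rewrite lnXn ?ltr0n // -(mulr_natl (ln _)) => h.
have h2 : t%:R * 2^-1 <= t%:R * ln 2%:R :> R by apply: ler_wpM2l ln2_ge.
have h3 := ln_nat_ge n1; rewrite -[t.+1%:R]natr1; lra.
Qed.

End Logarithm.

(** The sum of the six task bounds with a = r, b = s, g = #S, and u, v the binary lengths of q and
    l. The premises bound each nonlinear monomial by a multiple of W, X or Y, or by another such
    monomial, so that what remains is linear. *)
Lemma cost_arith (R : realType) (W a b u g v cK cm X Y : R) :
  W * (a * u) <= X -> W * a <= X -> W * b <= X -> W <= X ->
  a * a <= W * a -> cK * (a * u) <= 4%:R * W * (a * u) ->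
  b * cK * b <= 4%:R * W * b -> b * a * b <= W * b ->
  cm * (b * a * u) <= 31%:R * X -> b * a * (b * a * u) <= X ->
  g * (b * a) <= Y -> g * v * (b * a) <= Y -> g * v * cm <= 31%:R * Y ->
  b * a <= W -> b * cK <= 4%:R * W -> cm <= 31%:R * W -> 0 <= W -> 0 <= Y ->
  2%:R * a * (a * 2%:R) + (a * u * (2%:R * cK) + (b * (cK + a)
    + 2%:R * b * (b * (cK + a))))
  + (b * a + (b * a + (cm + (b * a + (a * b * u * (2%:R * cm) + b * a)))))
  + (b * a + a * b * u * (2%:R * cm + 2%:R * (b * a)))
  + (b * a + b * a)
  + (g * (b * a + v * (2%:R * cm + 2%:R * (b * a))) + g * (b * a))
  + (b * (a * u * (2%:R * cm)) + b * (b * a))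
  <= 254%:R * (X + Y).
Proof.
move=> *; have t0 : 2%:R * a * (a * 2%:R) + (a * u * (2%:R * cK) + (b * (cK + a)
    + 2%:R * b * (b * (cK + a)))) <= 27%:R * X by lra.
have t1 : b * a + (b * a + (cm + (b * a + (a * b * u * (2%:R * cm) + b * a))))
    <= 97%:R * X by lra.
have t2 : b * a + a * b * u * (2%:R * cm + 2%:R * (b * a)) <= 65%:R * X by lra.
have t4 : g * (b * a + v * (2%:R * cm + 2%:R * (b * a))) + g * (b * a)
    <= 66%:R * Y by lra.
have t5 : b * (a * u * (2%:R * cm)) + b * (b * a) <= 63%:R * X by lra.
lra.
Qed.

Section CostBound.
Variables (R : realType) (M : nat -> R).
Hypotheses (M_mul : multiplication_time M) (M_sup : superlinear M).

(** A program without instructions only copies 0, 1, a or b, and none of these is ab for all a, b in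
    F_3. It follows that n <= M n, by which the linear costs are absorbed into M. *)
Lemma M1_ge1 : 1 <= M 1.
Proof.
have [A A_cost AE] := M_mul (p := 3) isT isT (m := 1) isT.
apply: le_trans A_cost; rewrite ler1n lt0n; apply/negP => /nilP code0.
have {}AE (a b : 'F_3) : slp_run A [:: a; b] = Some [:: a * b].
  have := AE a%:P b%:P; rewrite !size_polyC => /(_ (leq_b1 _) (leq_b1 _)).
  by rewrite -polyCM muln1 /mkseq /= !coefC.
have out1 : exists j, outs A = [:: j].
  have := AE 0 0; rewrite /slp_run code0 /= => -[].
  by case: (outs A) => [//|j [|//] ] _; exists j.
have [j jE] := out1.
have {}AE (a b : 'F_3) : [:: 0; 1; a; b]`_j = a * b.
  by have := AE a b; rewrite /slp_run code0 /= jE => -[].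
have := AE 0 0; have := AE 1 0; have := AE 0 1; have := AE 1 1.
case: j {jE out1 AE} => [|[|[|[|j] ] ] ] /=.
- by move=> /eqP.
- by move=> _ _ _ /eqP.
- by move=> _ _ /eqP.
- by move=> _ /eqP.
- by rewrite nth_nil => /eqP.
Qed.

Lemma M_ge n : (0 < n)%N -> n%:R <= M n.
Proof.
move=> n0; have := M_sup.1 1 n; rewrite n0 => /(_ isT); rewrite divr1 => h.
have := le_trans M1_ge1 h; rewrite ler_pdivlMr ?ltr0n //.
by rewrite mul1r.
Qed.

Lemma M_mul_le m n : (0 < m)%N -> (0 < n)%N -> m%:R * M n <= M (m * n).
Proof.
move=> m0 n0; have := M_sup.1 n (m * n).
rewrite n0 leq_pmull // => /(_ isT).
rewrite ler_pdivrMr ?ltr0n // mulrAC ler_pdivlMr ?ltr0n ?muln_gt0 ?m0 //.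
rewrite natrM mulrA => h.
have : (m%:R * M n - M (m * n)) * n%:R <= 0.
  by rewrite mulrBl subr_le0 (mulrC m%:R).
by rewrite pmulr_lle0 ?ltr0n // subr_le0.
Qed.

Section OneParams.
Variables (P : params) (Am : nat -> slp).
Hypothesis Am_cost : forall m, (0 < m)%N -> (slp_cost (Am m))%:R <= M m.
Let tq := (trunc_log 2 (q P)).+1.
Let tl := (trunc_log 2 (l P)).+1.
Local Notation B := (task_bound P Am tq tl).
Let W : R := M (s P * r P).
Let a : R := (r P)%:R.
Let b : R := (s P)%:R.
Let u : R := tq%:R.
Let v : R := tl%:R.

(* The constant is 27 + 97 + 65 + 2 + 63: each task but [Eta] is bounded by a
   multiple of [W * (b * a * u)]; [Eta] takes 66 times the other summand. *)
Lemma task_bound_total :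
  (B Construct)%:R + (B Residuosity)%:R + (B Zeta)%:R + (B NotTwo)%:R
    + (B Eta)%:R + (B Trace)%:R
  <= 254%:R * (W * (b * a * u + (l P)%:R / a * v)).
Proof.
have [r0 s0] := rs_gt0 P.
have a1 : 1 <= a by rewrite ler1n.
have b1 : 1 <= b by rewrite ler1n.
have u1 : 1 <= u by rewrite ler1n.
have v1 : 1 <= v by rewrite ler1n.
have sr0 : (0 < s P * r P)%N by rewrite muln_gt0 s0.
have baW : b * a <= W by rewrite -natrM; apply: M_ge.
pose kr : R := (slp_cost (Am (r P)))%:R.
pose kp : R := (slp_cost (Am (2 * r P * s P)))%:R.
have kr0 : 0 <= kr by [].
have bkrW : b * kr <= W.
  apply: le_trans (M_mul_le s0 r0); apply: ler_wpM2l => //; exact: Am_cost.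
(* The packed product has size 2rs, and M (2 m) <= 4 M m by quadratic growth. *)
have kpW : kp <= 4%:R * W.
  apply: le_trans (Am_cost _) _; first by rewrite !muln_gt0 r0.
  rewrite -mulnA (mulnC (r P)); apply: le_trans (M_sup.2 2 _ isT sr0) _.
  by rewrite -natrX.
have W0 : 0 <= W by apply: le_trans baW; rewrite mulr_ge0.
pose g : R := #|Sgrp P|%:R.
have g0 : 0 <= g by [].
(* The order of S is (l - 1) / (2rs). *)
have ga : g <= (l P)%:R / a.
  rewrite ler_pdivlMr ?(lt_le_trans ltr01) // -natrM ler_nat.
  apply: leq_trans (leq_pred _); rewrite -card_Sgrp mulnC leq_mul2r.
  by rewrite (mulnC 2) -mulnA leq_pmulr ?muln_gt0 ?orbT.
have aW : a <= W by apply: le_trans baW; rewrite ler_peMl // (le_trans ler01).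
pose cK : R := 3%:R * kr + a.
have bcK : b * cK <= 4%:R * W by rewrite /cK; lra.
have cK0 : 0 <= cK by rewrite /cK; lra.
pose ca : R := b * a.
pose cm : R := 3%:R * (kp + 2%:R * b * (2%:R * kr + a)) + b * a.
have ca0 : 0 <= ca by rewrite mulr_ge0 //; lra.
(* The 31 is 3 (4 + 4 + 2) + 1: from [kp] at most 4 W, [b * kr] and [b * a] at most W. *)
have cmW : cm <= 31%:R * W by rewrite /cm; lra.
have cm0 : 0 <= cm.
  have : 0 <= kp by []. have : 0 <= b * kr by rewrite mulr_ge0.
  by rewrite /cm; move: ca0; rewrite /ca; lra.
have caE : (adk' P)%:R = ca by rewrite /adk' muln1 natrM.
have cKE : (costK P (fun m => slp_cost (Am m)))%:R = cK.
  by rewrite /costK muln1 natrD natrM.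
have cmE : (costk' P (fun m => slp_cost (Am m)))%:R = cm.
  by rewrite /costk' /costKP muln1 !(natrD, natrM).
pose X := W * (b * a * u); pose Y := W * ((l P)%:R / a * v).
have au1 : 1 <= a * u by rewrite -[1]mulr1 ler_pM.
have bu1 : 1 <= b * u by rewrite -[1]mulr1 ler_pM.
have bau : a * u <= b * a * u by rewrite -mulrA ler_peMl // (le_trans ler01).
have XWau : W * (a * u) <= X by apply: ler_wpM2l.
have XWa : W * a <= X.
  by apply: ler_wpM2l => //; rewrite mulrAC ler_peMl // (le_trans ler01).
have XWb : W * b <= X.
  by apply: ler_wpM2l => //; rewrite -mulrA ler_peMr // (le_trans ler01).
have XW : W <= X.
  by apply: le_trans XWa; rewrite ler_peMr.
have au0 : 0 <= a * u by apply: le_trans au1.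
have a0 : 0 <= a by apply: le_trans a1.
have b0 : 0 <= b by apply: le_trans b1.
have bau0 : 0 <= b * a * u by apply: le_trans bau.
have v0 : 0 <= v by apply: le_trans v1.
have p1 : a * a <= W * a by apply: ler_wpM2r.
have cK4 : cK <= 4%:R * W by apply: le_trans bcK; rewrite ler_peMl.
have p2 : cK * (a * u) <= 4%:R * W * (a * u) by apply: ler_wpM2r.
have p3 : b * cK * b <= 4%:R * W * b by apply: ler_wpM2r.
have p4 : b * a * b <= W * b by apply: ler_wpM2r.
have p5 : cm * (b * a * u) <= 31%:R * X.
  by rewrite /X [leRHS]mulrA; apply: ler_wpM2r.
have p6 : b * a * (b * a * u) <= X by rewrite /X; apply: ler_wpM2r.
have gv : g * v <= (l P)%:R / a * v by apply: ler_wpM2r.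
have gg : g <= (l P)%:R / a * v.
  by apply: le_trans gv; rewrite ler_peMr.
have gv0 : 0 <= g * v by rewrite mulr_ge0.
have p7 : g * (b * a) <= Y.
  rewrite /Y mulrC; apply: le_trans (ler_wpM2r g0 baW) _; exact: ler_wpM2l.
have p8 : g * v * (b * a) <= Y.
  rewrite /Y mulrC; apply: le_trans (ler_wpM2r gv0 baW) _; exact: ler_wpM2l.
have p9 : g * v * cm <= 31%:R * Y.
  rewrite /Y mulrC; apply: le_trans (ler_wpM2r gv0 cmW) _.
  by rewrite -(mulrA _ W); apply: ler_wpM2l => //; apply: ler_wpM2l.
have Y0 : 0 <= Y by apply: le_trans p7; rewrite mulr_ge0 // mulr_ge0.
rewrite /task_bound.
move: (adk' P) (costK P _) (costk' P _) caE cKE cmE => ca' cK' cm' caE cKE cmE.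
rewrite !muln1 !(natrD, natrM) caE cKE cmE -/a -/b -/u -/v -/g.
have -> : W * (b * a * u + (l P)%:R / a * v) = X + Y by rewrite mulrDr.
rewrite /ca.
exact: (cost_arith XWau XWa XWb XW p1 p2 p3 p4 p5 p6 p7 p8 p9).
Qed.

End OneParams.
End CostBound.

Section Complexity.
Variables (R : realType) (M : nat -> R).
Hypotheses (M_mul : multiplication_time M) (M_sup : superlinear M).

Definition conic_time (P : params) : R :=
  M (s P * r P)%N * ((s P * r P)%:R * ln (q P)%:R
    + (l P)%:R / (r P)%:R * ln (l P)%:R).

(* The constant: 6 for the loops, 254 for the tasks, and 4 for the passage from
   binary lengths to logarithms. *)
Lemma conic_implementation (P : params) : exists A : task -> slp,
  (forall D : input P, implements D A) /\
  (forall D : input P,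
     (average_cost D R A <= (6 * (254 * 4) * conic_time P)%:E)%E).
Proof.
have exA m : exists A : slp, (0 < m)%N -> (slp_cost A)%:R <= M m /\
    forall a b : {poly 'F_(q P)}, (size a <= m)%N -> (size b <= m)%N ->
    slp_run A (mkseq (nth 0 a) m ++ mkseq (nth 0 b) m) =
    Some (mkseq (nth 0 (a * b)) (2 * m).-1).
  have [m0|m0] := posnP m; first by exists (Slp [::] [::]); rewrite m0.
  by have [A Ac AE] := M_mul (q_prime P) (q_odd P) m0; exists A.
have [Am AmP] := choice exA.
have Am_cost m : (0 < m)%N -> (slp_cost (Am m))%:R <= M m.
  by move=> /AmP[].
have AmE m : (0 < m)%N -> forall a b : {poly 'F_(q P)},
    (size a <= m)%N -> (size b <= m)%N ->
    slp_run (Am m) (mkseq (nth 0 a) m ++ mkseq (nth 0 b) m) =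
    Some (mkseq (nth 0 (a * b)) (2 * m).-1).
  by move=> /AmP[].
have [A [A_impl A_cost] ] := implementation AmE
  (@trunc_log_ltn 2 (q P) isT) (@trunc_log_ltn 2 (l P) isT).
exists A; split=> // D; apply: le_trans (expected_cost_rains_conic R D _) _.
rewrite lee_fin -!mulrA.
apply: ler_wpM2l; first exact: ler0n.
have [r0 s0] := rs_gt0 P.
have q1 : (1 < q P)%N := prime_gt1 (q_prime P).
have M0 : 0 <= M (s P * r P).
  by apply: le_trans (M_ge M_mul M_sup _); rewrite // muln_gt0 s0.
apply: (@le_trans _ _ (254%:R * (M (s P * r P)%N *
  ((s P)%:R * (r P)%:R * (trunc_log 2 (q P)).+1%:R
   + (l P)%:R / (r P)%:R * (trunc_log 2 (l P)).+1%:R)))).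
  apply: le_trans (task_bound_total M_mul M_sup P Am_cost).
  by do !apply: lerD; rewrite ler_nat.
apply: ler_wpM2l => //.
rewrite /conic_time mulrCA; apply: ler_wpM2l => //.
rewrite mulrDr natrM; apply: lerD; rewrite mulrCA; apply: ler_wpM2l.
- by rewrite mulr_ge0.
- exact: trunc_log_ln.
- by rewrite divr_ge0.
- exact: trunc_log_ln (l_gt1 P).
Qed.

End Complexity.

(** As l > 2rs, the last premise forces r >= 2 (N + 8): so the condition on l alone makes sr large
    enough for the asymptotic bound on M, and at least 16, which gives ln (sr) >= 2. Of the three
    logarithms, two come from M and one from ln l <= 2 ln (sr), since l <= s r^2 <= (sr)^2. *)
Lemma conic_time_quasilinear (R : realType) (M : nat -> R) (c : R) (N : nat)
    (P : params) : 0 < c -> (forall m, (0 < m)%N -> 0 <= M m) ->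
  (forall m, (N <= m)%N ->
     `|M m| <= c * `|m%:R * ln m%:R * ln (ln m%:R)|) ->
  (l P * (N + 8) <= s P * r P ^ 2)%N ->
  conic_time M P <= 5 * c * ((s P * r P)%:R ^+ 2 * ln (q P)%:R
    * ln (s P * r P)%:R ^+ 3).
Proof.
move=> c0 M0 MP lP; have [r0 s0] := rs_gt0 P.
have l_gt : (2 * r P * s P < l P)%N.
  by have := card_Sgrp P; have := cardG_gt0 (Sgrp P); have := l_gt1 P; nia.
have r_ge : (2 * (N + 8) <= r P)%N.
  rewrite -(leq_pmul2l (_ : 0 < r P * s P)%N) ?muln_gt0 ?r0 //.
  by have := leq_mul (ltnW l_gt) (leqnn (N + 8)%N); nia.
have l_le : (l P <= s P * r P * r P)%N by nia.
set n := (s P * r P)%N in l_le *.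
have n_ge : (2 * (N + 8) <= n)%N by apply: leq_trans r_ge _; apply: leq_pmull.
pose x : R := n%:R; pose L := ln x; pose q' := ln (q P)%:R : R.
have x0 : 0 < x by rewrite ltr0n; lia.
have L2 : 2 <= L.
  have h : ln (2%:R ^+ 4) <= L.
    by apply: ln_le; rewrite -natrX ?ltr0n // ler_nat; lia.
  by move: h; rewrite lnXn ?ltr0n // -(mulr_natl (ln _)); have := ln2_ge R; lra.
have q'1 : 2^-1 <= q' by apply: ln_nat_ge; apply: prime_gt1 (q_prime P).
have L0 : 0 < L by lra.
have lnL0 : 0 <= ln L by apply: ln_ge0; lra.
have lnL : ln L <= L by apply/ltW/ln_sublinear.
have Mn : M n <= c * (x * L * L).
  apply: le_trans (ler_norm _) (le_trans (MP n _) _); first by lia.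
  apply: ler_wpM2l; first exact: ltW.
  rewrite -/x -/L !normrM (gtr0_norm x0) (gtr0_norm L0) (ger0_norm lnL0).
  by apply: ler_wpM2l lnL; rewrite mulr_ge0 // ltW.
have lr : (l P)%:R / (r P)%:R <= x :> R.
  by rewrite ler_pdivrMr ?ltr0n // -natrM ler_nat.
have lnl : ln (l P)%:R <= 2 * L.
  have h : ln (l P)%:R <= ln (x ^+ 2).
    apply: ln_le; first by rewrite ltr0n ltnW ?l_gt1.
    by rewrite -natrX ler_nat (leq_trans l_le) // expnS expn1 leq_mul2l
      leq_pmull ?orbT.
  by move: h; rewrite lnXn // -(mulr_natl L).
have lnl0 : 0 <= ln (l P)%:R :> R by apply: ln_ge0; rewrite ler1n ltnW ?l_gt1.
have e1 : (l P)%:R / (r P)%:R * ln (l P)%:R <= x * (2 * L).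
  by apply: ler_pM => //; rewrite divr_ge0.
(* With L >= 2 and q' >= 1/2, q' is at most q' L / 2 and 2 L at most 4 q' L; hence the factor 5. *)
have e2 : x * q' + (l P)%:R / (r P)%:R * ln (l P)%:R <= x * (5 * q' * L).
  apply: (@le_trans _ _ (x * q' + x * (2 * L))); first by rewrite lerD2l.
  by rewrite -mulrDr; apply: ler_wpM2l; [exact: ltW | nra].
have -> : 5 * c * (x ^+ 2 * q' * L ^+ 3) = c * (x * L * L) * (x * (5 * q' * L)).
  by ring.
rewrite /conic_time -/n -/x -/q'; apply: ler_pM Mn e2.
  by apply: M0; rewrite muln_gt0 s0.
have q'0 : 0 <= q' by lra.
by rewrite addr_ge0 ?mulr_ge0 ?divr_ge0 // ltW.
Qed.

Theorem proposition28 (R : realType) :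
  (forall (P : params) (D : input P) (cost : task -> nat),
     [/\ termination_prob R (rains_conic D cost) = 1%E,
         forall zeta : quo (h_irr D),
           (quo_trace (eta zeta))%:A
           = \sum_(i < s P) bracket (q P ^ (r P * i)) (eta zeta) &
         forall (g : {poly finvect_type (k D)}) (g_irr : irreducible_poly g),
           size g = (2 * s P).+1 ->
         forall alpha beta : finvect_type (k D),
           outcome (rains_conic D cost) alpha ->
           outcome (rains_cyclotomic g_irr) beta ->
           same_galois_orbit alpha beta]) /\
  (forall M : nat -> R,
     multiplication_time M -> superlinear M -> almost_linear M ->
   exists A : params -> task -> slp,
     [/\ forall (P : params) (D : input P), implements D (A P),
         exists C : R, forall (P : params) (D : input P),
           (average_cost D R (A P) <=
            (C * (M (s P * r P)%N *
                  ((s P * r P)%:R * ln (q P)%:R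
                   + (l P)%:R / (r P)%:R * ln (l P)%:R)))%:E)%E &
         quasilinear M ->
         forall (P : nat -> params) (D : forall n, input (P n)),
           (fun n => (l (P n))%:R : R)
             =o_\oo (fun n => (s (P n) * r (P n) ^ 2)%:R : R) ->
         exists (C : R) (e : nat), \forall n \near \oo,
           (average_cost (D n) R (A (P n)) <=
            (C * ((s (P n) * r (P n))%:R ^+ 2 * ln (q (P n))%:R
                  * ln (s (P n) * r (P n))%:R ^+ e))%:E)%E]).
Proof.
split=> [P D cost|M M_mul M_sup M_lin].
  split; first exact: termination_rains_conic.
    move=> zeta; rewrite (quo_trace_frobenius (q_prime P) (card_k D)) h_size.
    apply: eq_bigr => i _.
    by rewrite (bracket_pchar _ _ (pchar_k' D)) card_k expnM.
  move=> g g_irr g_size alpha beta; exact: conic_cyclotomic_orbit.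
have [A AP] := choice (conic_implementation M_mul M_sup).
exists A; split=> [P D|| M_ql P D l_o].
- exact: (AP P).1.
- by exists (6 * (254 * 4)) => P D; apply: (AP P).2.
have /eqO_exP[c c0 [N _ NP] ] := M_ql.
(* The little-o is used at this single epsilon, fixed by the rank N from which the bound on M
   holds. *)
have eps0 : 0 < (N + 8)%:R^-1 :> R by rewrite invr_gt0 ltr0n addn_gt0 orbT.
have /eqoP/(_ _ eps0) near_l := l_o.
exists (6 * (254 * 4) * (5 * c)), 3%N.
apply: filterS near_l => n /=.
rewrite !ger0_norm // mulrC ler_pdivlMr ?ltr0n ?addn_gt0 ?orbT //.
rewrite -(natrM _ (l (P n))) ler_nat => l_le.
apply: le_trans ((AP (P n)).2 (D n)) _.
rewrite lee_fin -[leRHS]mulrA; apply: ler_wpM2l; first by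
  rewrite mulr_ge0 ?mulr_ge0 ?ler0n.
apply: (conic_time_quasilinear (N := N)) => //.
by move=> m m0; apply: le_trans (M_ge M_mul M_sup m0).
Qed.
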